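(* Let $X$ be a separable symmetric sequence space of fundamental type and $1\le p\le\infty$. The following are equivalent: (i) $\ell^p$ is symmetrically block finitely represented in the unit vector basis $\{e_k\}$ of $X$; (ii) $\ell^p$ is symmetrically finitely represented in $X$; (iii) $\ell^p$ is crudely symmetrically finitely represented in $X$; (iv) $p\in[1/\beta_X,1/\alpha_X]$ (with $1/0=\infty$).
   Context: A Banach sequence lattice is a Banach space $E$ of real sequences such that $x\in E$, $|y_k|\le|x_k|$ imply $y\in E$, $\|y\|_E\le\|x\|_E$. $u^*$ is the nonincreasing rearrangement of $(|u_k|)$. A symmetric sequence space is a Banach sequence lattice $X\subset\ell^\infty$ with $x\in X$, $y^*=x^*$ implying $y\in X$, $\|y\|_X=\|x\|_X$. Boyd indices: $\alpha_X=-\lim_m\frac{\log_2\|\sigma_{1/m}\|_X}{\log_2m}$, $\beta_X=\lim_m\frac{\log_2\|\sigma_m\|_X}{\log_2m}$, where $\sigma_ma=(a_{[(m-1+n)/m]})_n$, $\sigma_{1/m}a=(\frac1m\sum_{k=(n-1)m+1}^{nm}a_k)_n$. With $\varphi_X(n)=\|\sum_{i=1}^ne_i\|_X$, $M^0_X(n)=\sup_m\varphi_X(m)/\varphi_X(mn)$, $M^\infty_X(n)=\sup_m\varphi_X(mn)/\varphi_X(m)$, $\mu_X=-\lim_n\frac{\log_2M^0_X(n)}{\log_2n}$, $\nu_X=\lim_n\frac{\log_2M^\infty_X(n)}{\log_2n}$; $X$ is of fundamental type if $\alpha_X=\mu_X$, $\beta_X=\nu_X$. Sequences $x,y$ have the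 same ordered distribution if $y_{\pi(k)}=x_k$ for some permutation $\pi$ of $\mathbb N$; finite blocks $\sum_{i=1}^m\alpha_ie_{n_i}$, $\sum_{i=1}^m\beta_ie_{k_i}$ (increasing indices) have the same ordered distribution if $\beta_i=\alpha_{\pi(i)}$ for a permutation $\pi$ of $\{1,\dots,m\}$. $\|a\|_p$ is the $\ell^p$ norm on $\mathbb R^n$ (max norm for $p=\infty$). $\ell^p$ is symmetrically block finitely represented in $\{e_k\}$ if for all $n,\varepsilon>0$ there are $0=m_0<\dots<m_n$ and reals $\alpha_i$ such that the blocks $u_k=\sum_{i=m_{k-1}+1}^{m_k}\alpha_ie_i$ pairwise have the same ordered distribution and $(1+\varepsilon)^{-1}\|a\|_p\le\|\sum a_ku_k\|_X\le(1+\varepsilon)\|a\|_p$ for all $a\in\mathbb R^n$. $\ell^p$ is symmetrically finitely represented in $X$ if for all $n,\varepsilon>0$ there are pairwise disjointly supported $x_1,\dots,x_n\in X$, pairwise with the same ordered distribution, satisfying the same two-sided $(1+\varepsilon)$ estimate; crudely symmetrically finitely represented if there is $C>0$ such that for every $n$ such $x_1,\dots,x_n$ exist with $C^{-1}\|a\|_p\le\|\sum a_kx_k\|_X\le C\|a\|_p$. *)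

(* Defs.v *)
From Stdlib Require Import Reals Lra Lia List Permutation.
From Coquelicot Require Import Coquelicot.
Open Scope R_scope.

(* Real sequences are functions nat -> R, indexed from 0 (the paper's e_1 is
   position 0 here). *)
Definition rseq := nat -> R.

Fixpoint fsum (f : nat -> R) (n : nat) : R :=
  match n with O => 0 | S n' => fsum f n' + f n' end.
Fixpoint fmaxabs (f : nat -> R) (n : nat) : R :=
  match n with O => 0 | S n' => Rmax (fmaxabs f n') (Rabs (f n')) end.

Definition sadd (x y : rseq) : rseq := fun k => x k + y k.
Definition sscal (c : R) (x : rseq) : rseq := fun k => c * x k.
Definition ssub (x y : rseq) : rseq := fun k => x k - y k.
Definition szero : rseq := fun _ => 0.
Definition slincomb (n : nat) (a : nat -> R) (x : nat -> rseq) : rseq :=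
  fun j => fsum (fun k => a k * x k j) n.

(* Nonincreasing rearrangement u^* of (|u_k|), 0-indexed:
   u^*_n = inf { r | exists F finite, |F| <= n, |u_k| <= r for k notin F }
   (= +oo if u is unbounded). *)
Definition rearr (u : rseq) (n : nat) : Rbar :=
  Glb_Rbar (fun r : R => exists F : list nat, (length F <= n)%nat /\
              forall k, ~ In k F -> Rabs (u k) <= r).

Definition is_banach_seq_space (X : rseq -> Prop) (nX : rseq -> R) : Prop :=
  X szero /\
  (forall x y, X x -> X y -> X (sadd x y)) /\
  (forall c x, X x -> X (sscal c x)) /\
  (forall x, X x -> 0 <= nX x) /\
  (forall x, X x -> nX x = 0 -> x = szero) /\
  (forall c x, X x -> nX (sscal c x) = Rabs c * nX x) /\
  (forall x y, X x -> X y -> nX (sadd x y) <= nX x + nX y) /\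
  (forall s : nat -> rseq, (forall j, X (s j)) ->
     (forall eps, 0 < eps -> exists N, forall i j, (N <= i)%nat -> (N <= j)%nat ->
         nX (ssub (s i) (s j)) < eps) ->
     exists x, X x /\ forall eps, 0 < eps -> exists N, forall i, (N <= i)%nat ->
         nX (ssub (s i) x) < eps).

Definition is_banach_seq_lattice (X : rseq -> Prop) (nX : rseq -> R) : Prop :=
  is_banach_seq_space X nX /\
  forall x y, X x -> (forall k, Rabs (y k) <= Rabs (x k)) -> X y /\ nX y <= nX x.

Definition is_symmetric_seq_space (X : rseq -> Prop) (nX : rseq -> R) : Prop :=
  is_banach_seq_lattice X nX /\
  (forall x, X x -> exists M, forall k, Rabs (x k) <= M) /\
  (forall x y, X x -> (forall n, rearr y n = rearr x n) -> X y /\ nX y = nX x).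

Definition separable (X : rseq -> Prop) (nX : rseq -> R) : Prop :=
  exists D : nat -> rseq, (forall n, X (D n)) /\
    forall x eps, X x -> 0 < eps -> exists n, nX (ssub x (D n)) < eps.

Definition sigma_up (m : nat) (a : rseq) : rseq := fun j => a (Nat.div j m).
Definition sigma_down (m : nat) (a : rseq) : rseq :=
  fun j => / INR m * fsum (fun i => a (j * m + i)%nat) m.

Definition opnorm (X : rseq -> Prop) (nX : rseq -> R) (T : rseq -> rseq) : R :=
  real (Lub_Rbar (fun r => exists x, X x /\ nX x <= 1 /\ r = nX (T x))).

Definition log2 (r : R) : R := ln r / ln 2.

Definition boyd_alpha (X : rseq -> Prop) (nX : rseq -> R) : R :=
  real (Lim_seq (fun m => - (log2 (opnorm X nX (sigma_down m)) / log2 (INR m)))).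
Definition boyd_beta (X : rseq -> Prop) (nX : rseq -> R) : R :=
  real (Lim_seq (fun m => log2 (opnorm X nX (sigma_up m)) / log2 (INR m))).

Definition indic (n : nat) : rseq := fun k => if Nat.ltb k n then 1 else 0.
Definition fund (nX : rseq -> R) (n : nat) : R := nX (indic n).

Definition M0 (nX : rseq -> R) (n : nat) : R :=
  real (Lub_Rbar (fun r => exists m, (1 <= m)%nat /\
                     r = fund nX m / fund nX (m * n))).
Definition Minf (nX : rseq -> R) (n : nat) : R :=
  real (Lub_Rbar (fun r => exists m, (1 <= m)%nat /\
                     r = fund nX (m * n) / fund nX m)).

Definition fund_mu (nX : rseq -> R) : R :=
  real (Lim_seq (fun n => - (log2 (M0 nX n) / log2 (INR n)))).
Definition fund_nu (nX : rseq -> R) : R :=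
  real (Lim_seq (fun n => log2 (Minf nX n) / log2 (INR n))).

Definition fundamental_type (X : rseq -> Prop) (nX : rseq -> R) : Prop :=
  boyd_alpha X nX = fund_mu nX /\ boyd_beta X nX = fund_nu nX.

Definition powabs (x q : R) : R := if Req_EM_T x 0 then 0 else Rpower (Rabs x) q.

Definition lp_norm (p : Rbar) (n : nat) (a : nat -> R) : R :=
  match p with
  | Finite q => powabs (fsum (fun k => powabs (a k) q) n) (/ q)
  | _ => fmaxabs a n
  end.

Definition same_od (x y : rseq) : Prop :=
  exists pi pinv : nat -> nat,
    (forall k, pinv (pi k) = k) /\ (forall k, pi (pinv k) = k) /\
    forall k, y (pi k) = x k.

Definition lp_equiv (nX : rseq -> R) (p : Rbar) (n : nat) (x : nat -> rseq) (C : R) :=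
  forall a : nat -> R,
    / C * lp_norm p n a <= nX (slincomb n a x) <= C * lp_norm p n a.

(* (i) symmetric block finite representability in the unit vector basis.
   Blocks: 0 = m_0 < m_1 < ... < m_n, block k (1 <= k <= n) has coefficients
   c at (0-indexed) positions m_{k-1}, ..., m_k - 1. *)
Definition block (m : nat -> nat) (c : nat -> R) (k : nat) : rseq :=
  fun j => if andb (Nat.leb (m (pred k)) j) (Nat.ltb j (m k)) then c j else 0.
Definition block_coeffs (m : nat -> nat) (c : nat -> R) (k : nat) : list R :=
  map c (seq (m (pred k)) (m k - m (pred k))).

Definition sym_block_fin_rep (X : rseq -> Prop) (nX : rseq -> R) (p : Rbar) : Prop :=
  forall (n : nat) (eps : R), 0 < eps ->
    exists (m : nat -> nat) (c : nat -> R),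
      m 0%nat = 0%nat /\ (forall k, (k < n)%nat -> (m k < m (S k))%nat) /\
      (forall k l, (1 <= k <= n)%nat -> (1 <= l <= n)%nat ->
          Permutation (block_coeffs m c k) (block_coeffs m c l)) /\
      (forall k, (1 <= k <= n)%nat -> X (block m c k)) /\
      lp_equiv nX p n (fun k => block m c (S k)) (1 + eps).

Definition good_family (X : rseq -> Prop) (n : nat) (x : nat -> rseq) : Prop :=
  (forall k, (k < n)%nat -> X (x k)) /\
  (forall i j, (i < n)%nat -> (j < n)%nat -> i <> j ->
      forall t, x i t = 0 \/ x j t = 0) /\
  (forall i j, (i < n)%nat -> (j < n)%nat -> same_od (x i) (x j)).

Definition sym_fin_rep (X : rseq -> Prop) (nX : rseq -> R) (p : Rbar) : Prop :=
  forall (n : nat) (eps : R), 0 < eps ->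
    exists x : nat -> rseq, good_family X n x /\ lp_equiv nX p n x (1 + eps).

Definition crude_sym_fin_rep (X : rseq -> Prop) (nX : rseq -> R) (p : Rbar) : Prop :=
  exists C : R, 0 < C /\ forall n : nat,
    exists x : nat -> rseq, good_family X n x /\ lp_equiv nX p n x C.

Definition inv_ext (r : R) : Rbar := if Req_EM_T r 0 then p_infty else Finite (/ r).

(* Main.v *)
Require Import Defs.
From Stdlib Require Import Reals Lra Lia List Permutation FinFun.
From Stdlib Require Import Classical ClassicalEpsilon FunctionalExtensionality.
From Coquelicot Require Import Coquelicot.
Open Scope R_scope.

(* Put theta = 1/p, with theta = 0 for p = oo.

   Necessity.  If x_0, ..., x_(n-1) are disjoint copies of x spanning l^p up to a
   constant C, then x_0 + ... + x_(n-1) is a rearrangement of sigma_n x, so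
   |sigma_n x| ~ n^theta |x| up to C^2, while sigma_(1/n) sigma_n x = x; letting
   n grow gives alpha_X <= theta <= beta_X.

   Sufficiency.  Fundamental type turns alpha_X <= theta <= beta_X into
   mu_X <= theta <= nu_X, which only involves the fundamental function.  It
   provides a finitely supported v with sigma_m v ~ m^theta v in norm for all
   m <= M: a truncation of t^(-theta) times a slowly varying weight.  In
   a_1 v (+) ... (+) a_n v with |a_k|^p ~ m_k / N, each summand m_k^theta v can
   then be replaced by m_k copies of v, and the sum m_1 + ... + m_n ~ N of
   copies by N^theta v; hence disjoint copies of v span l^p almost
   isometrically. *)

(** * Symmetric sequence spaces *)

(** A plain truncation of t^(-theta) fails: under dilation its defect sits at the two edges, and
    nothing makes these small against the whole norm. The indices provide only isolated scales: one
    step from A to A n where the fundamental function grows at least like n^(theta - e/2), and one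
    step from B' to B' n' where it grows at most like n'^(theta + e/2). Tilting the weight by the
    power e across exactly these steps beats the loss e/2 and leaves a factor n^(-e/2) or n'^(-e/2)
    at the edges. Between the edges the weight has slope at most e in ln t, so dilation by m <= M
    changes it by a factor at most M^e, close to 1. For B' to lie beyond A n, growth and decay must
    be available at arbitrarily large scales.

    Every equality of norms comes from two injections of coordinates, one in each direction, fed to
    [X_dom]; no rearrangement is computed. The limits defining the indices are never shown to exist:
    [Lim_seq] is total, and bounds holding for all large indices are enough. *)

Lemma fsum_ext f g n :
  (forall k, (k < n)%nat -> f k = g k) -> fsum f n = fsum g n.
Proof.
  induction n as [|n IH]; intros H; simpl; [reflexivity|].
  rewrite IH, H; auto.
Qed.

Lemma fsum_le f g n :
  (forall k, (k < n)%nat -> f k <= g k) -> fsum f n <= fsum g n.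
Proof.
  induction n as [|n IH]; intros H; simpl; [lra|].
  apply Rplus_le_compat; auto.
Qed.

Lemma fsum_const c n : fsum (fun _ => c) n = INR n * c.
Proof.
  induction n as [|n IH]; [simpl; ring|].
  rewrite S_INR; simpl fsum; rewrite IH; ring.
Qed.

Lemma fsum_zero f n : (forall k, (k < n)%nat -> f k = 0) -> fsum f n = 0.
Proof.
  intros H; rewrite (fsum_ext f (fun _ => 0)) by auto.
  rewrite fsum_const; ring.
Qed.

Lemma fsum_single f n k :
  (k < n)%nat -> (forall l, (l < n)%nat -> l <> k -> f l = 0) -> fsum f n = f k.
Proof.
  induction n as [|n IH]; intros Hk H; [lia|]; simpl.
  destruct (Nat.eq_dec k n) as [->|Hn].
  - rewrite fsum_zero by (intros l Hl; apply H; lia); ring.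
  - rewrite IH, (H n) by (lia || (intros l Hl; apply H; lia)); ring.
Qed.

Lemma fsum_scal c f n : fsum (fun k => c * f k) n = c * fsum f n.
Proof.
  induction n as [|n IH]; simpl; [ring|rewrite IH; ring].
Qed.

Lemma fsum_plus f g n : fsum (fun k => f k + g k) n = fsum f n + fsum g n.
Proof. induction n as [|n IH]; simpl; [ring|rewrite IH; ring]. Qed.

Lemma fsum_nonneg f n : (forall k, (k < n)%nat -> 0 <= f k) -> 0 <= fsum f n.
Proof.
  intros H; rewrite <- (fsum_zero (fun _ => 0) n) by auto.
  apply fsum_le; exact H.
Qed.

(** * Indices as pairs, rearrangements, disjoint sums *)

Lemma divmod_pair t n r :
  (r < n)%nat -> ((t * n + r) / n = t /\ (t * n + r) mod n = r)%nat.
Proof.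
  intros H; split.
  - rewrite Nat.div_add_l by lia. rewrite Nat.div_small; lia.
  - rewrite Nat.add_comm, Nat.Div0.mod_add, Nat.mod_small; lia.
Qed.

Lemma divmod_eq j n : (n <> 0)%nat -> (j = j / n * n + j mod n)%nat.
Proof. intros H; rewrite (Nat.div_mod_eq j n) at 1; lia. Qed.

Lemma pair_inj n r t r' t' :
  (r < n)%nat -> (r' < n)%nat -> (t * n + r = t' * n + r')%nat -> r = r' /\ t = t'.
Proof.
  intros Hr Hr' E.
  destruct (divmod_pair t n r Hr), (divmod_pair t' n r' Hr'); rewrite E in *; lia.
Qed.

(** If [F] is an exceptional set for [v], then its image under [g] is one for [u], with the same
    bound [r]. At zeros of [u] the bound needs 0 <= [r], which holds because some index lies outside
    the finite [F]. *)
Lemma rearr_le (u v : rseq) (f g : nat -> nat) :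
  (forall i, u i <> 0 -> g (f i) = i /\ Rabs (u i) <= Rabs (v (f i))) ->
  forall n, Rbar_le (rearr u n) (rearr v n).
Proof.
  intros H n; unfold rearr; apply Glb_Rbar_correct; intros r [F [HF Hr]].
  apply Glb_Rbar_correct; exists (map g F); split.
  { rewrite length_map; exact HF. }
  intros k Hk; destruct (Req_dec (u k) 0) as [E|E].
  - assert (exists j, ~ In j F) as [j Hj].
    { exists (S (list_max F)); intros Hin.
      assert (Hm := proj1 (list_max_le F (list_max F)) (le_n _)).
      rewrite Forall_forall in Hm; specialize (Hm _ Hin); lia. }
    rewrite E, Rabs_R0; eapply Rle_trans; [apply Rabs_pos|apply (Hr j Hj)].
  - destruct (H k E) as [H1 H2].
    eapply Rle_trans; [exact H2|apply Hr].
    intros Hin; apply Hk; rewrite <- H1; apply in_map; exact Hin.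
Qed.

Definition restrict (P : nat -> Prop) (x : rseq) : rseq :=
  fun j => if excluded_middle_informative (P j) then x j else 0.

Lemma restrict_in (P : nat -> Prop) x j : P j -> restrict P x j = x j.
Proof. intros H; unfold restrict; destruct excluded_middle_informative; tauto. Qed.

Lemma restrict_out (P : nat -> Prop) x j : ~ P j -> restrict P x j = 0.
Proof. intros H; unfold restrict; destruct excluded_middle_informative; tauto. Qed.

(** Disjoint sum: the members occupy the residue classes modulo their number, which leaves room for
    infinite supports. By symmetry the placement does not affect the norm. *)
Definition merge (ls : list rseq) : rseq :=
  fun j => nth (j mod length ls)%nat ls szero (j / length ls)%nat.

(** Agrees with [sigma_up] for [m] > 0. The value zero at [m] = 0 stands for no copies of [v], so
    that multiplicity 0 needs no special case later. *)
Definition dil (m : nat) (v : rseq) : rseq :=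
  fun j => if Nat.eqb m 0 then 0 else v (j / m)%nat.

Lemma merge_at ls r t :
  (r < length ls)%nat -> merge ls (t * length ls + r)%nat = nth r ls szero t.
Proof.
  intros H; unfold merge; destruct (divmod_pair t _ _ H) as [-> ->]; reflexivity.
Qed.

Lemma merge_coord ls j :
  merge ls j <> 0 ->
  exists r t, (r < length ls)%nat /\ j = (t * length ls + r)%nat /\
    nth r ls szero t <> 0.
Proof.
  unfold merge; intros H.
  assert (length ls <> 0)%nat.
  { intros E; apply H; rewrite nth_overflow; [reflexivity|lia]. }
  exists (j mod length ls)%nat, (j / length ls)%nat; repeat split; auto.
  - apply Nat.mod_upper_bound; auto.
  - apply divmod_eq; auto.
Qed.

Section Lattice.
Context (X : rseq -> Prop) (nX : rseq -> R).
Context (HX : is_symmetric_seq_space X nX).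

Lemma X_zero : X szero.
Proof. apply HX. Qed.

Lemma X_add x y : X x -> X y -> X (sadd x y).
Proof. apply HX. Qed.

Lemma X_scal c x : X x -> X (sscal c x).
Proof. apply HX. Qed.

Lemma nX_pos x : X x -> 0 <= nX x.
Proof. apply HX. Qed.

Lemma nX_sep x : X x -> nX x = 0 -> x = szero.
Proof. apply HX. Qed.

Lemma nX_scal c x : X x -> nX (sscal c x) = Rabs c * nX x.
Proof. apply HX. Qed.

Lemma nX_add x y : X x -> X y -> nX (sadd x y) <= nX x + nX y.
Proof. apply HX. Qed.

Lemma X_lattice x y :
  X x -> (forall k, Rabs (y k) <= Rabs (x k)) -> X y /\ nX y <= nX x.
Proof. apply HX. Qed.

Lemma X_rearr x y : X x -> (forall n, rearr y n = rearr x n) -> X y /\ nX y = nX x.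
Proof. apply HX. Qed.

Lemma nX_zero : nX szero = 0.
Proof.
  replace szero with (sscal 0 szero).
  - rewrite nX_scal, Rabs_R0 by apply X_zero; ring.
  - apply functional_extensionality; intros j; unfold sscal, szero; ring.
Qed.

(* Symmetry and the lattice property combined: [u] restricted to the range of
   [g] is rearranged into a majorant of [v]. *)
Lemma X_dom u v (g : nat -> nat) :
  X u ->
  (forall j, v j <> 0 -> Rabs (v j) <= Rabs (u (g j))) ->
  (forall i j, v i <> 0 -> v j <> 0 -> g i = g j -> i = j) ->
  X v /\ nX v <= nX u.
Proof.
  intros Hu Hle Hinj.
  set (P := fun i => exists j, v j <> 0 /\ g j = i).
  set (f := fun i => epsilon (inhabits 0%nat) (fun j => v j <> 0 /\ g j = i)).
  assert (Hf : forall j, v j <> 0 -> f (g j) = j).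
  { intros j Hj. assert (Hex : exists j', v j' <> 0 /\ g j' = g j) by eauto.
    destruct (epsilon_spec (inhabits 0%nat) _ Hex) as [H1 H2].
    apply Hinj; auto. }
  (* [u'] keeps the values of [u] that [g] hits from the support of [v]; [v'] is [u'] carried back
     along [g], hence has the same rearrangement and dominates [v]. *)
  set (u' := restrict P u).
  set (v' := fun j => if Req_EM_T (v j) 0 then 0 else u (g j)).
  destruct (X_lattice u u' Hu) as [Hu' Lu'].
  { intros k; unfold u', restrict; destruct excluded_middle_informative; [lra|].
    rewrite Rabs_R0; apply Rabs_pos. }
  destruct (X_rearr u' v' Hu') as [Hv' Lv'].
  { intros n; apply Rbar_le_antisym.
    - apply rearr_le with (f := g) (g := f); intros i Hi.
      unfold v' in *; destruct (Req_EM_T (v i) 0) as [E|E]; [lra|].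
      unfold u'; rewrite restrict_in by (exists i; auto).
      split; [auto|lra].
    - apply rearr_le with (f := f) (g := g); intros i Hi.
      unfold u' in *.
      destruct (classic (P i)) as [HP|HP]; [|rewrite restrict_out in Hi; tauto].
      rewrite restrict_in in * by auto.
      destruct HP as [j [Hj <-]]; rewrite Hf by auto; split; [reflexivity|].
      unfold v'; destruct (Req_EM_T (v j) 0); [tauto|lra]. }
  destruct (X_lattice v' v Hv') as [Hv Lv].
  { intros k; unfold v'; destruct (Req_EM_T (v k) 0) as [E|E].
    - rewrite E; lra.
    - auto. }
  split; [exact Hv|lra].
Qed.

Lemma X_mono u v :
  X u -> (forall j, Rabs (v j) <= Rabs (u j)) -> nX v <= nX u.
Proof. intros Hu H; apply X_lattice; auto. Qed.

Lemma X_sub x y : X x -> X y -> X (ssub x y).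
Proof.
  intros Hx Hy; replace (ssub x y) with (sadd x (sscal (-1) y)).
  - apply X_add; auto; apply X_scal; auto.
  - apply functional_extensionality; intros j; unfold sadd, sscal, ssub; ring.
Qed.

Lemma X_fsum (F : nat -> rseq) n :
  (forall k, (k < n)%nat -> X (F k)) ->
  X (fun j => fsum (fun k => F k j) n) /\
  nX (fun j => fsum (fun k => F k j) n) <= fsum (fun k => nX (F k)) n.
Proof.
  induction n as [|n IH]; intros H; simpl.
  - split; [apply X_zero|]. change (nX szero <= 0); rewrite nX_zero; lra.
  - destruct IH as [I1 I2]; [auto|].
    assert (HF : X (F n)) by auto.
    split.
    + exact (X_add _ _ I1 HF).
    + eapply Rle_trans; [exact (nX_add _ _ I1 HF)|lra].
Qed.

(** * Dilations and averaging *)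

(** The dilation is the sum of its restrictions to the [m] residue classes, each a spread-out copy
    of [x]; then the triangle inequality. *)
Lemma X_sigma_up m x :
  (m <> 0)%nat -> X x -> X (sigma_up m x) /\ nX (sigma_up m x) <= INR m * nX x.
Proof.
  intros Hm Hx.
  set (F := fun i : nat => fun j : nat =>
              if Nat.eqb (j mod m) i then x (j / m)%nat else 0).
  assert (HF : forall i, X (F i) /\ nX (F i) <= nX x).
  { intros i; apply X_dom with (g := fun j => (j / m)%nat); auto.
    - intros j; unfold F; destruct (Nat.eqb _ _); intros; lra.
    - intros j j'; unfold F.
      destruct (Nat.eqb_spec (j mod m) i), (Nat.eqb_spec (j' mod m) i); try tauto.
      intros _ _ E; rewrite (divmod_eq j m), (divmod_eq j' m) by auto; lia. }
  destruct (X_fsum F m) as [H1 H2]; [intros; apply HF|].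
  replace (sigma_up m x) with (fun j => fsum (fun k => F k j) m).
  - split; auto. eapply Rle_trans; [exact H2|].
    rewrite <- fsum_const; apply fsum_le; intros; apply HF.
  - apply functional_extensionality; intros j; unfold sigma_up.
    rewrite (fsum_single _ _ (j mod m)%nat).
    + unfold F; rewrite Nat.eqb_refl; reflexivity.
    + apply Nat.mod_upper_bound; auto.
    + intros l _ Hl; unfold F; destruct (Nat.eqb_spec (j mod m) l); [lia|reflexivity].
Qed.

(** The averaging operator is the mean of [m] subsequences of [x], none of norm larger than that of
    [x]. *)
Lemma X_sigma_down m x :
  (m <> 0)%nat -> X x -> X (sigma_down m x) /\ nX (sigma_down m x) <= nX x.
Proof.
  intros Hm Hx.
  set (F := fun i : nat => fun j : nat => x (j * m + i)%nat).
  assert (HF : forall i, X (F i) /\ nX (F i) <= nX x).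
  { intros i; apply X_dom with (g := fun j => (j * m + i)%nat); auto.
    - intros j; unfold F; lra.
    - intros j j' _ _ E; nia. }
  destruct (X_fsum F m) as [H1 H2]; [intros; apply HF|].
  assert (Hp : 0 < INR m) by (apply lt_0_INR; lia).
  change (sigma_down m x) with (sscal (/ INR m) (fun j => fsum (fun k => F k j) m)).
  split; [apply X_scal; auto|].
  rewrite nX_scal, Rabs_pos_eq by (auto; left; apply Rinv_0_lt_compat; auto).
  apply (Rmult_le_reg_l (INR m)); auto.
  rewrite <- Rmult_assoc, Rinv_r, Rmult_1_l by lra.
  eapply Rle_trans; [exact H2|].
  rewrite <- fsum_const; apply fsum_le; intros; apply HF.
Qed.

Lemma X_dil m v : X v -> X (dil m v).
Proof.
  intros Hv; unfold dil; destruct (Nat.eqb_spec m 0); [apply X_zero|].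
  apply X_sigma_up; auto.
Qed.

Lemma X_merge ls : List.Forall X ls -> X (merge ls).
Proof.
  intros H.
  set (n := length ls).
  set (F := fun i : nat => fun j : nat =>
              if Nat.eqb (j mod n) i then nth i ls szero (j / n)%nat else 0).
  assert (HF : forall i, (i < n)%nat -> X (F i)).
  { intros i Hi; apply X_dom with (u := nth i ls szero) (g := fun j => (j / n)%nat).
    - rewrite Forall_forall in H; apply H, nth_In; auto.
    - intros j; unfold F; destruct (Nat.eqb _ _); intros; lra.
    - intros j j'; unfold F.
      destruct (Nat.eqb_spec (j mod n) i), (Nat.eqb_spec (j' mod n) i); try tauto.
      intros _ _ E; rewrite (divmod_eq j n), (divmod_eq j' n) by lia; lia. }
  destruct (Nat.eq_dec n 0) as [E|E].
  { replace (merge ls) with szero; [apply X_zero|].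
    destruct ls; [|discriminate].
    apply functional_extensionality; intros j; unfold merge.
    rewrite nth_overflow by (simpl; lia); reflexivity. }
  replace (merge ls) with (fun j => fsum (fun k => F k j) n).
  - apply X_fsum; auto.
  - apply functional_extensionality; intros j; unfold merge.
    rewrite (fsum_single _ _ (j mod n)%nat).
    + unfold F; rewrite Nat.eqb_refl; reflexivity.
    + apply Nat.mod_upper_bound; auto.
    + intros l _ Hl; unfold F; destruct (Nat.eqb_spec (j mod n) l); [lia|reflexivity].
Qed.

(** [X_dom] in pair coordinates: entry [t] of member [r] is sent to entry [h r t] of member [f r t].
    The comparisons of disjoint sums below only have to name [f] and [h]. *)
Lemma merge_dom ls ls' (f : nat -> nat -> nat) (h : nat -> nat -> nat) :
  X (merge ls') ->
  (forall r t, (r < length ls)%nat -> nth r ls szero t <> 0 ->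
     (f r t < length ls')%nat /\
     Rabs (nth r ls szero t) <= Rabs (nth (f r t) ls' szero (h r t))) ->
  (forall r t r' t', (r < length ls)%nat -> (r' < length ls)%nat ->
     nth r ls szero t <> 0 -> nth r' ls szero t' <> 0 ->
     f r t = f r' t' -> h r t = h r' t' -> r = r' /\ t = t') ->
  nX (merge ls) <= nX (merge ls').
Proof.
  intros HX' Hle Hinj.
  set (n := length ls) in *; set (n' := length ls') in *.
  apply (X_dom (merge ls') (merge ls)
    (fun j => h (j mod n) (j / n) * n' + f (j mod n) (j / n))%nat); auto.
  - intros j Hj; destruct (merge_coord _ _ Hj) as (r & t & Hr & -> & H0).
    fold n in Hr |- *; destruct (divmod_pair t n r Hr) as [-> ->].
    destruct (Hle r t Hr H0) as [H1 H2].
    unfold n, n'; rewrite !merge_at by assumption; exact H2.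
  - intros i j Hi Hj.
    destruct (merge_coord _ _ Hi) as (r & t & Hr & -> & H0).
    destruct (merge_coord _ _ Hj) as (r' & t' & Hr' & -> & H0').
    fold n in Hr, Hr' |- *.
    destruct (divmod_pair t n r Hr) as [-> ->], (divmod_pair t' n r' Hr') as [-> ->].
    intros E; destruct (pair_inj n' (f r t) (h r t) (f r' t') (h r' t')) as [E1 E2].
    + apply Hle; auto.
    + apply Hle; auto.
    + exact E.
    + destruct (Hinj r t r' t') as [-> ->]; auto.
Qed.

Lemma merge_perm_le ls ls' :
  List.Forall X ls' -> Permutation ls' ls -> nX (merge ls) <= nX (merge ls').
Proof.
  intros HF HP.
  destruct (proj1 (Permutation_nth ls' ls szero) HP) as (E & f & F1 & F2 & F3).
  apply merge_dom with (f := fun r _ => f r) (h := fun _ t => t).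
  - apply X_merge; auto.
  - intros r t Hr _; rewrite E in Hr; split; [auto|rewrite F3 by auto; lra].
  - intros r t r' t' Hr Hr' _ _; rewrite E in Hr, Hr'; intros; split; auto.
Qed.

Lemma merge_perm ls ls' :
  List.Forall X ls -> Permutation ls ls' -> nX (merge ls) = nX (merge ls').
Proof.
  intros HF HP; apply Rle_antisym; apply merge_perm_le; auto.
  - rewrite <- HP; auto.
  - symmetry; auto.
Qed.

Lemma merge_mono ls ls' :
  List.Forall X ls' ->
  Forall2 (fun x y : rseq => forall t, Rabs (x t) <= Rabs (y t)) ls ls' ->
  nX (merge ls) <= nX (merge ls').
Proof.
  intros HF H.
  assert (El := Forall2_length H).
  apply merge_dom with (f := fun r _ => r) (h := fun _ t => t).
  - apply X_merge; auto.
  - intros r t Hr _; split; [lia|].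
    clear HF El; revert r Hr; induction H; intros r Hr; simpl in *; [lia|].
    destruct r; auto; apply IHForall2; lia.
  - auto.
Qed.

Lemma nth_repeat_app (A : Type) (v : A) m ls d r :
  nth r (repeat v m ++ ls) d = if Nat.ltb r m then v else nth (r - m)%nat ls d.
Proof.
  destruct (Nat.ltb_spec r m).
  - rewrite app_nth1 by (rewrite repeat_length; auto).
    rewrite (nth_indep _ d v) by (rewrite repeat_length; auto). apply nth_repeat.
  - rewrite app_nth2 by (rewrite repeat_length; auto).
    rewrite repeat_length; reflexivity.
Qed.

(** Position t of the dilation corresponds to position t / [m] of copy t mod [m]. This is what turns
    an approximate eigenvector equation for [dil] into a rule for replacing one summand by [m]
    copies. *)
Lemma merge_dil m v ls :
  X v -> List.Forall X ls ->
  nX (merge (dil m v :: ls)) = nX (merge (repeat v m ++ ls)).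
Proof.
  intros Hv HF.
  assert (HF1 : List.Forall X (dil m v :: ls)) by (constructor; auto; apply X_dil; auto).
  assert (HF2 : List.Forall X (repeat v m ++ ls)).
  { apply Forall_app; split; auto.
    apply Forall_forall; intros x Hx; apply repeat_spec in Hx; subst; auto. }
  assert (Hlen : length (repeat v m ++ ls) = (m + length ls)%nat)
    by (rewrite length_app, repeat_length; reflexivity).
  apply Rle_antisym.
  - apply merge_dom with
      (f := fun r t => match r with O => (t mod m)%nat | S r' => (m + r')%nat end)
      (h := fun r t => match r with O => (t / m)%nat | S r' => t end).
    + apply X_merge; auto.
    + intros [|r] t Hr; rewrite Hlen, nth_repeat_app; simpl in *.
      * unfold dil; destruct (Nat.eqb_spec m 0) as [E|E]; [tauto|]; intros _.
        pose proof (Nat.mod_upper_bound t m E).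
        destruct (Nat.ltb_spec (t mod m) m); [|lia]; split; [lia|lra].
      * intros _. destruct (Nat.ltb_spec (m + r) m); [lia|].
        replace (m + r - m)%nat with r by lia; split; [lia|lra].
    + intros [|r] t [|r'] t' Hr Hr'; simpl in *; unfold dil;
        destruct (Nat.eqb_spec m 0) as [E|E]; try tauto; intros _ _ E1 E2.
      * rewrite (divmod_eq t m), (divmod_eq t' m) by auto; split; lia.
      * pose proof (Nat.mod_upper_bound t m E); lia.
      * pose proof (Nat.mod_upper_bound t' m E); lia.
      * split; lia.
      * split; lia.
  - apply merge_dom with
      (f := fun r t => if Nat.ltb r m then 0%nat else S (r - m)%nat)
      (h := fun r t => if Nat.ltb r m then (t * m + r)%nat else t).
    + apply X_merge; auto.
    + intros r t; rewrite Hlen, nth_repeat_app; intros Hr _.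
      destruct (Nat.ltb_spec r m) as [H|H]; simpl.
      * split; [lia|]. unfold dil; destruct (Nat.eqb_spec m 0); [lia|].
        destruct (divmod_pair t m r H) as [-> _]; lra.
      * split; [lia|lra].
    + intros r t r' t' Hr Hr' _ _.
      destruct (Nat.ltb_spec r m) as [H|H], (Nat.ltb_spec r' m) as [H'|H'];
        intros E1 E2; try discriminate.
      * destruct (pair_inj m r t r' t'); auto.
      * split; lia.
Qed.

(** The two sums differ by [ssub x y] placed in residue class 0, a sequence of no larger norm. *)
Lemma merge_perturb x y ls :
  X x -> X y -> List.Forall X ls ->
  nX (merge (x :: ls)) <= nX (merge (y :: ls)) + nX (ssub x y).
Proof.
  intros Hx Hy HF.
  set (n := S (length ls)).
  set (d := fun j => if Nat.eqb (j mod n) 0 then ssub x y (j / n)%nat else 0).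
  destruct (X_dom (ssub x y) d (fun j => (j / n)%nat)) as [Hd Ld].
  - apply X_sub; auto.
  - intros j; unfold d; destruct (Nat.eqb _ _); intros; lra.
  - intros j j'; unfold d.
    destruct (Nat.eqb_spec (j mod n) 0), (Nat.eqb_spec (j' mod n) 0); try tauto.
    intros _ _ E; rewrite (divmod_eq j n), (divmod_eq j' n) by (unfold n; lia); lia.
  - assert (Hm : X (merge (y :: ls))) by (apply X_merge; auto).
    replace (merge (x :: ls)) with (sadd (merge (y :: ls)) d).
    + eapply Rle_trans; [apply nX_add; auto|lra].
    + apply functional_extensionality; intros j; unfold sadd, merge, d.
      change (length (y :: ls)) with n; change (length (x :: ls)) with n.
      destruct (j mod n)%nat eqn:E; simpl; unfold ssub; ring.
Qed.

Lemma X_finite n v : X (indic 1) -> (forall j, (n <= j)%nat -> v j = 0) -> X v.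
Proof.
  intros H1; revert v; induction n as [|n IH]; intros v Hv.
  - replace v with szero; [apply X_zero|].
    apply functional_extensionality; intros j; rewrite Hv; auto; lia.
  - set (e := fun j => if Nat.eqb j n then v n else 0).
    replace v with (sadd (fun j => if Nat.eqb j n then 0 else v j) e).
    + apply X_add.
      * apply IH; intros j Hj; destruct (Nat.eqb_spec j n); auto; apply Hv; lia.
      * apply (X_dom (sscal (v n) (indic 1)) e (fun _ => 0%nat)).
        -- apply X_scal; auto.
        -- intros j; unfold e, sscal, indic; simpl.
           destruct (Nat.eqb j n); [rewrite Rmult_1_r|]; lra.
        -- intros i j; unfold e; destruct (Nat.eqb_spec i n), (Nat.eqb_spec j n);
             try tauto; intros; lia.
    + apply functional_extensionality; intros j; unfold sadd, e.
      destruct (Nat.eqb_spec j n); subst; ring.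
Qed.

(** Move one nonzero coordinate to position 0. With [X_finite], a nonzero space contains every
    finitely supported sequence. *)
Lemma X_indic1 : (exists x, X x /\ x <> szero) -> X (indic 1).
Proof.
  intros [x [Hx Hn]].
  assert (exists k, x k <> 0) as [k Hk].
  { apply NNPP; intros H; apply Hn, functional_extensionality; intros k.
    apply NNPP; intros Hk; apply H; exists k; exact Hk. }
  apply (X_dom (sscal (/ x k) x) (indic 1) (fun _ => k)).
  - apply X_scal; auto.
  - intros j _; unfold sscal, indic; rewrite Rinv_l by auto.
    rewrite Rabs_R1; destruct (Nat.ltb j 1); rewrite ?Rabs_R1, ?Rabs_R0; lra.
  - intros [|i] [|j]; unfold indic; simpl; try reflexivity; tauto.
Qed.

(** * The fundamental function *)

Section Fundamental.
Context (H1 : X (indic 1)).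

Lemma X_indic n : X (indic n).
Proof.
  apply X_finite with n; auto; intros j Hj; unfold indic.
  destruct (Nat.ltb_spec j n); [lia|reflexivity].
Qed.

Lemma fund_mono m n : (m <= n)%nat -> fund nX m <= fund nX n.
Proof.
  intros H; apply X_mono; [apply X_indic|]; intros j; unfold indic.
  destruct (Nat.ltb_spec j m), (Nat.ltb_spec j n); try lia;
    rewrite ?Rabs_R0, ?Rabs_R1; lra.
Qed.

Lemma fund_pos n : (1 <= n)%nat -> 0 < fund nX n.
Proof.
  intros H; apply Rlt_le_trans with (fund nX 1); [|apply fund_mono; auto].
  destruct (nX_pos _ H1) as [H0|H0]; [exact H0|].
  symmetry in H0; apply nX_sep in H0; auto.
  apply (f_equal (fun x => x 0%nat)) in H0; unfold indic, szero in H0; simpl in H0; lra.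
Qed.

Lemma fund_mul m n : (1 <= m)%nat -> fund nX (n * m)%nat <= INR m * fund nX n.
Proof.
  intros H; unfold fund.
  replace (indic (n * m)%nat) with (sigma_up m (indic n)).
  - apply X_sigma_up; [lia|apply X_indic].
  - apply functional_extensionality; intros j; unfold sigma_up, indic.
    destruct (Nat.ltb_spec (j / m) n) as [A|A], (Nat.ltb_spec j (n * m)) as [B|B];
      auto; exfalso.
    + rewrite (divmod_eq j m) in B by lia.
      pose proof (Nat.mod_upper_bound j m); nia.
    + rewrite Nat.mul_comm in B; apply Nat.Div0.div_lt_upper_bound in B; lia.
Qed.

End Fundamental.
End Lattice.

(** * Growth of the fundamental function *)

Lemma exp_le_exp x y : x <= y -> exp x <= exp y.
Proof. intros [H| -> ]; [left; apply exp_increasing; exact H|lra]. Qed.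

(** [real] sends infinite values to 0. Here 0 <= [c] covers an empty [E]; in the next lemma an upper
    bound of [E] rules out +oo. *)
Lemma Lub_real_le (E : R -> Prop) c :
  0 <= c -> (forall r, E r -> r <= c) -> real (Lub_Rbar E) <= c.
Proof.
  intros Hc H.
  assert (L : Rbar_le (Lub_Rbar E) c)
    by (apply Lub_Rbar_correct; intros r Hr; exact (H r Hr)).
  destruct (Lub_Rbar E); simpl in *; tauto || lra.
Qed.

Lemma Lub_real_ge (E : R -> Prop) c r :
  (forall r, E r -> r <= c) -> E r -> r <= real (Lub_Rbar E).
Proof.
  intros H Hr.
  assert (L : Rbar_le (Lub_Rbar E) c)
    by (apply Lub_Rbar_correct; intros r' Hr'; exact (H r' Hr')).
  assert (L' : Rbar_le r (Lub_Rbar E)) by (apply Lub_Rbar_correct; exact Hr).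
  destruct (Lub_Rbar E); simpl in *; tauto || lra.
Qed.

(** Bounds on both sides are asked for even when one is wanted: they exclude an infinite limit,
    which [real] would turn into 0. No convergence is claimed. *)
Lemma Lim_seq_between (u : nat -> R) a b N :
  (forall n, (N <= n)%nat -> a <= u n <= b) -> a <= real (Lim_seq u) <= b.
Proof.
  intros H.
  assert (L1 : Rbar_le (Lim_seq (fun _ => a)) (Lim_seq u))
    by (apply Lim_seq_le_loc; exists N; intros; apply H; auto).
  assert (L2 : Rbar_le (Lim_seq u) (Lim_seq (fun _ => b)))
    by (apply Lim_seq_le_loc; exists N; intros; apply H; auto).
  rewrite Lim_seq_const in L1, L2.
  destruct (Lim_seq u); simpl in *; tauto || lra.
Qed.

Lemma log2_quot x y : log2 x / log2 y = ln x / ln y.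
Proof.
  pose proof ln_lt_2. unfold log2, Rdiv.
  rewrite Rinv_mult, Rinv_inv.
  replace (ln x * / ln 2 * (/ ln y * ln 2)) with (ln x * / ln y * (ln 2 * / ln 2)) by ring.
  rewrite Rinv_r by lra; ring.
Qed.

Lemma ln_INR_pos n : (2 <= n)%nat -> 0 < ln (INR n).
Proof.
  intros H; rewrite <- ln_1; apply ln_increasing; [lra|].
  apply (lt_INR 1); lia.
Qed.

Lemma ln_INR_nonneg n : (1 <= n)%nat -> 0 <= ln (INR n).
Proof.
  intros H; rewrite <- ln_1; apply ln_le; [lra|]. apply (le_INR 1); lia.
Qed.

Lemma ln_INR_unbounded c : exists N, forall n, (N <= n)%nat -> c <= ln (INR n).
Proof.
  destruct (INR_unbounded (exp c)) as [N HN].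
  exists N; intros n Hn; rewrite <- (ln_exp c); apply ln_le; [apply exp_pos|].
  apply le_INR in Hn; lra.
Qed.

Lemma ln_quot_between n x a b :
  (2 <= n)%nat -> exp (a * ln (INR n)) <= x <= exp (b * ln (INR n)) ->
  a <= ln x / ln (INR n) <= b.
Proof.
  intros Hn [H1 H2]; pose proof (ln_INR_pos n Hn) as Hl.
  assert (Hx : 0 < x) by (pose proof (exp_pos (a * ln (INR n))); lra).
  apply ln_le in H1; [|apply exp_pos]; apply ln_le in H2; [|exact Hx].
  rewrite ln_exp in H1, H2.
  split; apply (Rmult_le_reg_r (ln (INR n))); auto; unfold Rdiv;
    rewrite Rmult_assoc, Rinv_l, Rmult_1_r by lra; auto.
Qed.

Lemma exp_ln_INR n : (1 <= n)%nat -> exp (ln (INR n)) = INR n.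
Proof. intros H; apply exp_ln, lt_0_INR; lia. Qed.

Lemma exp_opp_ln_INR n : (1 <= n)%nat -> exp (-1 * ln (INR n)) = / INR n.
Proof.
  intros H; replace (-1 * ln (INR n)) with (- ln (INR n)) by ring.
  rewrite exp_Ropp, exp_ln_INR; auto.
Qed.

(** If the conclusion failed, the quotients would be at most [theta - delta] for all large n, and so
    would their limit. Stated for a general [rho] because [fund_nu] uses the ratio of the
    fundamental function and [fund_mu] its reciprocal. *)
Lemma exponent_attained (rho : nat -> nat -> R) theta :
  (forall m n, (1 <= m)%nat -> (1 <= n)%nat -> / INR n <= rho m n <= INR n) ->
  theta <= real (Lim_seq (fun n =>
    log2 (real (Lub_Rbar (fun r => exists m, (1 <= m)%nat /\ r = rho m n)))
      / log2 (INR n))) ->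
  forall delta N, 0 < delta -> exists n m, (N <= n)%nat /\ (1 <= m)%nat /\
    exp ((theta - delta) * ln (INR n)) <= rho m n.
Proof.
  intros Hrho Hlim delta N Hd; apply NNPP; intros Hno.
  match type of Hlim with _ <= real (Lim_seq ?u) =>
    (* The bound -1, from [rho] >= 1/n, only keeps the limit finite. *)
    destruct (Lim_seq_between u (-1) (theta - delta) (N + 2)) as [_ L] end; [|lra].
  intros n Hn; rewrite log2_quot; apply ln_quot_between; [lia|]; split.
  - rewrite exp_opp_ln_INR by lia.
    apply Rle_trans with (rho 1%nat n); [apply Hrho; lia|].
    apply Lub_real_ge with (INR n); [|exists 1%nat; auto].
    intros r [m [Hm ->]]; apply Hrho; lia.
  - apply Lub_real_le; [left; apply exp_pos|].
    intros r [m [Hm ->]]; apply Rnot_lt_le; intros Hlt; apply Hno.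
    exists n, m; repeat split; [lia|lia|lra].
Qed.

Section Growth.
Context (X : rseq -> Prop) (nX : rseq -> R).
Context (HX : is_symmetric_seq_space X nX) (H1 : X (indic 1)).
Let phi := fund nX.

Lemma fund_ratio m n :
  (1 <= m)%nat -> (1 <= n)%nat ->
  1 <= phi (m * n)%nat / phi m <= INR n /\
  / INR n <= phi m / phi (m * n)%nat <= 1.
Proof.
  intros Hm Hn.
  assert (P1 : 0 < phi m) by (eapply fund_pos; eauto).
  assert (L : phi m <= phi (m * n)%nat) by (eapply fund_mono; eauto; nia).
  assert (U : phi (m * n)%nat <= INR n * phi m) by (eapply fund_mul; eauto).
  assert (Hi : 0 < INR n) by (apply lt_0_INR; lia).
  assert (P2 : 0 < phi (m * n)%nat) by lra.
  repeat split.
  - apply Rle_div_r; lra.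
  - apply Rle_div_l; lra.
  - apply Rle_div_r; auto. apply (Rmult_le_reg_l (INR n)); auto.
    rewrite <- Rmult_assoc, Rinv_r, Rmult_1_l by lra; auto.
  - apply Rle_div_l; lra.
Qed.

Lemma fund_mu_nonneg : 0 <= fund_mu nX.
Proof.
  unfold fund_mu; apply (Lim_seq_between _ 0 1 2); intros n Hn; rewrite log2_quot.
  enough (-1 <= ln (M0 nX n) / ln (INR n) <= 0) by lra.
  apply ln_quot_between; auto; rewrite exp_opp_ln_INR, Rmult_0_l, exp_0 by lia.
  assert (B : forall r, (exists m, (1 <= m)%nat /\ r = fund nX m / fund nX (m * n)%nat) -> r <= 1)
    by (intros r [m [Hm ->]]; apply fund_ratio; lia).
  split.
  - apply Rle_trans with (fund nX 1 / fund nX (1 * n)%nat); [apply fund_ratio; lia|].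
    apply Lub_real_ge with 1; eauto.
  - apply Lub_real_le; auto; lra.
Qed.

Lemma fund_nu_nonneg : 0 <= fund_nu nX.
Proof.
  unfold fund_nu; apply (Lim_seq_between _ 0 1 2); intros n Hn; rewrite log2_quot.
  apply ln_quot_between; auto; rewrite Rmult_0_l, exp_0, Rmult_1_l, exp_ln_INR by lia.
  assert (B : forall r, (exists m, (1 <= m)%nat /\ r = fund nX (m * n)%nat / fund nX m) -> r <= INR n)
    by (intros r [m [Hm ->]]; apply fund_ratio; lia).
  split.
  - apply Rle_trans with (fund nX (1 * n)%nat / fund nX 1); [apply fund_ratio; lia|].
    apply Lub_real_ge with (INR n); eauto.
  - apply Lub_real_le; auto; apply pos_INR.
Qed.

Lemma INR_le_exp_eventually K delta :
  (1 <= K)%nat -> 0 < delta ->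
  exists N, forall n, (N <= n)%nat -> INR K <= exp (delta * ln (INR n)).
Proof.
  intros HK Hd; destruct (ln_INR_unbounded (ln (INR K) / delta)) as [N HN].
  exists N; intros n Hn; rewrite <- (exp_ln_INR K) by auto.
  apply exp_le_exp; specialize (HN n Hn); apply Rle_div_l in HN; lra.
Qed.

(* Replacing [m] by [m K] costs a factor at most [K], negligible against
   [n ^ (delta / 2)]. *)
Lemma fund_growth theta delta K N :
  theta <= fund_nu nX -> 0 < delta -> (1 <= K)%nat ->
  exists n m, (N <= n)%nat /\ (K <= m)%nat /\
    phi m * exp ((theta - delta) * ln (INR n)) <= phi (m * n)%nat.
Proof.
  intros Ht Hd HK.
  destruct (INR_le_exp_eventually K (delta / 2)) as [N' HN']; [auto|lra|].
  destruct (exponent_attained (fun m n => phi (m * n)%nat / phi m) theta)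
    with (delta := delta / 2) (N := (N + N' + 1)%nat) as (n & m & Hn & Hm & Hr).
  - intros m n Hm Hn; destruct (fund_ratio m n Hm Hn) as [[A B] [C D]].
    split; auto. apply Rle_trans with 1; auto.
    rewrite <- Rinv_1; apply Rinv_le_contravar; [lra|apply (le_INR 1); auto].
  - exact Ht.
  - lra.
  - assert (Pm : 0 < phi m) by (eapply fund_pos; eauto).
    exists n, (m * K)%nat; repeat split; [lia|nia|].
    apply Rle_div_r in Hr; auto.
    assert (E : exp ((theta - delta / 2) * ln (INR n)) =
                exp (delta / 2 * ln (INR n)) * exp ((theta - delta) * ln (INR n)))
      by (rewrite <- exp_plus; f_equal; field).
    assert (Hmul : phi (m * K)%nat <= INR K * phi m) by (eapply fund_mul; eauto).
    assert (Hmon : phi (m * n)%nat <= phi (m * K * n)%nat) by (eapply fund_mono; eauto; nia).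
    specialize (HN' n ltac:(lia)).
    pose proof (exp_pos ((theta - delta) * ln (INR n))).
    rewrite E in Hr.
    eapply Rle_trans; [|exact Hmon]; eapply Rle_trans; [|exact Hr].
    rewrite (Rmult_comm (exp (delta / 2 * _))), Rmult_assoc, (Rmult_comm (phi _)).
    apply Rmult_le_compat_l; [lra|]. eapply Rle_trans; [exact Hmul|].
    apply Rmult_le_compat_r; lra.
Qed.

(** The same trade with the reciprocal ratio and exponent - [theta]: here the factor [K] is lost in
    phi(m n K) <= K phi(m n). *)
Lemma fund_decay theta delta K N :
  fund_mu nX <= theta -> 0 < delta -> (1 <= K)%nat ->
  exists n m, (N <= n)%nat /\ (K <= m)%nat /\
    phi (m * n)%nat <= phi m * exp ((theta + delta) * ln (INR n)).
Proof.
  intros Ht Hd HK.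
  destruct (INR_le_exp_eventually K (delta / 2)) as [N' HN']; [auto|lra|].
  destruct (exponent_attained (fun m n => phi m / phi (m * n)%nat) (- theta))
    with (delta := delta / 2) (N := (N + N' + 1)%nat) as (n & m & Hn & Hm & Hr).
  - intros m n Hm Hn; destruct (fund_ratio m n Hm Hn) as [[A B] [C D]].
    split; auto; lra.
  (* The minus sign in [fund_mu] is moved outside the limit; should the limit be infinite, [real]
     gives 0 with either sign. *)
  - unfold fund_mu in Ht; rewrite Lim_seq_opp in Ht; unfold M0 in Ht.
    match goal with |- _ <= real (Lim_seq ?u) =>
      change (real (Rbar_opp (Lim_seq u)) <= theta) in Ht;
      destruct (Lim_seq u) end; simpl in *; lra.
  - lra.
  - assert (Pm : 0 < phi m) by (eapply fund_pos; eauto).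
    assert (Pmn : 0 < phi (m * n)%nat) by (eapply fund_pos; eauto; nia).
    exists n, (m * K)%nat; repeat split; [lia|nia|].
    apply Rle_div_r in Hr; auto.
    assert (E : exp ((theta + delta) * ln (INR n)) =
                exp (delta / 2 * ln (INR n)) * exp ((theta + delta / 2) * ln (INR n)))
      by (rewrite <- exp_plus; f_equal; field).
    assert (E' : exp ((theta + delta / 2) * ln (INR n)) *
                 exp ((- theta - delta / 2) * ln (INR n)) = 1)
      by (rewrite <- exp_plus, <- exp_0; f_equal; ring).
    assert (Hmul : phi (m * n * K)%nat <= INR K * phi (m * n)%nat)
      by (eapply fund_mul; eauto).
    assert (Hmon : phi m <= phi (m * K)%nat) by (eapply fund_mono; eauto; nia).
    specialize (HN' n ltac:(lia)).
    replace (m * K * n)%nat with (m * n * K)%nat by ring.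
    set (a := exp ((theta + delta / 2) * ln (INR n))) in *.
    set (b := exp ((- theta - delta / 2) * ln (INR n))) in *.
    assert (Pa : 0 < a) by apply exp_pos.
    assert (Hmn : phi (m * n)%nat <= a * phi m).
    { replace (phi (m * n)%nat) with (a * (b * phi (m * n)%nat))
        by (rewrite <- Rmult_assoc, E'; ring).
      apply Rmult_le_compat_l; lra. }
    rewrite E; eapply Rle_trans; [exact Hmul|].
    rewrite (Rmult_comm (phi _)), Rmult_assoc.
    apply Rmult_le_compat; [apply pos_INR|lra|exact HN'|].
    eapply Rle_trans; [exact Hmn|apply Rmult_le_compat_l; lra].
Qed.

End Growth.

(** * Almost eigenvectors of the dilations *)

Definition dist_interval (a b x : R) : R := Rmax 0 (Rmax (a - x) (x - b)).

(** Written in x = ln t, where dilation is translation: t^(-theta) times a weight whose logarithm is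
    [e]-Lipschitz. *)
Definition profile (theta e a b x : R) : R :=
  exp (- (theta * x + e * dist_interval a b x)).

Lemma dist_interval_lip a b x y :
  dist_interval a b x <= dist_interval a b y + Rabs (x - y).
Proof.
  unfold dist_interval, Rmax, Rabs.
  repeat destruct Rle_dec; destruct Rcase_abs; lra.
Qed.

(** The power part is exact; the weight costs at most [e * d] because [dist_interval] is
    1-Lipschitz. *)
Lemma profile_compare theta e a b x y d :
  0 <= e -> Rabs (x - y) <= d ->
  profile theta e a b y <= exp (theta * (x - y) + e * d) * profile theta e a b x.
Proof.
  intros He Hd; unfold profile; rewrite <- exp_plus; apply exp_le_exp.
  pose proof (dist_interval_lip a b x y).
  assert (e * dist_interval a b x <= e * (dist_interval a b y + d))
    by (apply Rmult_le_compat_l; lra).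
  lra.
Qed.

(** Index j represents t = j + 1, which keeps the logarithm meaningful at j = 0. *)
Definition truncated_profile (theta e a b : R) (A B : nat) : rseq :=
  fun j => if andb (Nat.leb A j) (Nat.ltb j B)
           then profile theta e a b (ln (INR (S j))) else 0.

Lemma truncated_profile_in theta e a b A B j :
  (A <= j < B)%nat ->
  truncated_profile theta e a b A B j = profile theta e a b (ln (INR (S j))).
Proof.
  intros [H1 H2]; unfold truncated_profile.
  destruct (Nat.leb_spec A j), (Nat.ltb_spec j B); simpl; lia || reflexivity.
Qed.

Lemma truncated_profile_out theta e a b A B j :
  (j < A \/ B <= j)%nat -> truncated_profile theta e a b A B j = 0.
Proof.
  intros H; unfold truncated_profile.
  destruct (Nat.leb_spec A j), (Nat.ltb_spec j B); simpl; lia || reflexivity.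
Qed.

Lemma truncated_profile_nonneg theta e a b A B j :
  0 <= truncated_profile theta e a b A B j.
Proof.
  unfold truncated_profile; destruct (andb _ _); [left; apply exp_pos|lra].
Qed.

Lemma ln_INR_mul m n :
  (1 <= m)%nat -> (1 <= n)%nat -> ln (INR (m * n)) = ln (INR m) + ln (INR n).
Proof. intros; rewrite mult_INR; apply ln_mult; apply lt_0_INR; lia. Qed.

Lemma ln_INR_le m n : (1 <= m)%nat -> (m <= n)%nat -> ln (INR m) <= ln (INR n).
Proof. intros; apply ln_le; [apply lt_0_INR; lia|apply le_INR; auto]. Qed.

(** With t = j + 1 and t' = j / m + 1 one has t <= m t' <= t + m. Hence t' is t / m up to a
    discretisation error m / t on the logarithmic scale. *)
Lemma ln_div_bounds m j :
  (1 <= m)%nat ->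
  ln (INR (S j)) <= ln (INR (S (j / m))) + ln (INR m) <=
    ln (INR (S j)) + INR m / INR (S j) /\
  ln (INR (S (j / m))) <= ln (INR (S j)).
Proof.
  intros Hm.
  pose proof (Nat.mod_upper_bound j m ltac:(lia)).
  pose proof (divmod_eq j m ltac:(lia)).
  assert (0 < INR (S j)) by (apply lt_0_INR; lia).
  rewrite <- ln_INR_mul by lia; repeat split.
  - apply ln_INR_le; nia.
  - apply Rle_trans with (ln (INR (S j + m))); [apply ln_INR_le; nia|].
    rewrite plus_INR.
    replace (INR (S j) + INR m) with (INR (S j) * (1 + INR m / INR (S j)))
      by (field; lra).
    assert (0 < INR m / INR (S j)) by (apply Rdiv_lt_0_compat; auto; apply lt_0_INR; lia).
    rewrite ln_mult by lra. apply Rplus_le_compat_l.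
    rewrite <- (ln_exp (INR m / INR (S j))) at 2.
    apply ln_le; [lra|apply exp_ineq1_le].
  - apply ln_INR_le; nia.
Qed.

Lemma indic_in n j : (j < n)%nat -> indic n j = 1.
Proof. intros H; unfold indic; destruct (Nat.ltb_spec j n); lia || reflexivity. Qed.

Lemma indic_nonneg n j : 0 <= indic n j.
Proof. unfold indic; destruct (Nat.ltb j n); lra. Qed.

(** Dilation by [m] replaces t^(-theta) by about m^theta t^(-theta). The three terms are the
    relative error where both sides are nonzero and the two edges, where only one side is. The
    budget [kappa] is split in halves: one for the weight, one for the discretisation. *)
Lemma truncated_profile_dilation theta e a b A B m M kappa :
  0 <= theta <= 1 -> 0 <= e -> (1 <= A)%nat -> (1 <= B)%nat ->
  (1 <= m <= M)%nat ->
  e * ln (INR M) <= kappa / 2 -> INR M <= kappa / 2 * INR A ->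
  let v := truncated_profile theta e a b A B in
  forall j,
  Rabs (v (j / m)%nat - exp (theta * ln (INR m)) * v j) <=
  (exp kappa - 1) * INR M * v j
  + INR M * exp kappa * profile theta e a b (ln (INR A)) * indic (m * A) j
  + INR M * exp kappa * profile theta e a b (ln (INR B)) * indic (m * B) j.
Proof.
  intros Ht He HA HB Hm HeM HkA v j.
  assert (Hlm : 0 <= ln (INR m) <= ln (INR M))
    by (split; [apply ln_INR_nonneg; lia|apply ln_INR_le; lia]).
  assert (Hem : 0 <= e * ln (INR m) <= kappa / 2).
  { split; [apply Rmult_le_pos; lra|].
    apply Rle_trans with (e * ln (INR M)); auto. apply Rmult_le_compat_l; lra. }
  assert (Hk : 0 <= kappa) by lra.
  assert (HE : 1 <= exp kappa) by (pose proof (exp_ineq1_le kappa); lra).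
  assert (HM : 1 <= INR M) by (apply (le_INR 1); lia).
  assert (Htm : 0 <= theta * ln (INR m) <= ln (INR m)) by nra.
  assert (HmM : exp (theta * ln (INR m)) <= INR M).
  { rewrite <- (exp_ln_INR M) by lia; apply exp_le_exp; lra. }
  pose proof (exp_pos (theta * ln (INR m))) as Hmt.
  destruct (ln_div_bounds m j ltac:(lia)) as [[D1 D2] D3].
  pose proof (truncated_profile_nonneg theta e a b A B j) as Vj; fold v in Vj.
  assert (PA : 0 < profile theta e a b (ln (INR A))) by apply exp_pos.
  assert (PB : 0 < profile theta e a b (ln (INR B))) by apply exp_pos.
  assert (T1 : 0 <= (exp kappa - 1) * INR M * v j)
    by (repeat apply Rmult_le_pos; lra).
  assert (T2 : 0 <= INR M * exp kappa * profile theta e a b (ln (INR A)) * indic (m * A) j)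
    by (repeat apply Rmult_le_pos; try apply indic_nonneg; lra).
  assert (T3 : 0 <= INR M * exp kappa * profile theta e a b (ln (INR B)) * indic (m * B) j)
    by (repeat apply Rmult_le_pos; try apply indic_nonneg; lra).
  assert (Hdj : (j / m <= j)%nat) by (apply Nat.Div0.div_le_upper_bound; nia).
  pose proof (Nat.mod_upper_bound j m ltac:(lia)) as Hmod.
  pose proof (divmod_eq j m ltac:(lia)) as Hdm.
  destruct (Nat.lt_ge_cases j A) as [JA|JA].
  { unfold v; rewrite !truncated_profile_out by lia.
    rewrite Rmult_0_r, Rminus_0_r, Rabs_R0; fold v; lra. }
  destruct (Nat.lt_ge_cases (j / m) A) as [SA|SA].
  (* Left edge: only [v j] can survive, and [j] < [m * A]. *)
  - assert (E0 : v (j / m)%nat = 0) by (apply truncated_profile_out; lia).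
    rewrite E0, Rminus_0_l, Rabs_Ropp, Rabs_pos_eq by (apply Rmult_le_pos; lra).
    destruct (Nat.lt_ge_cases j B) as [JB|JB].
    2:{ unfold v; rewrite truncated_profile_out by lia; fold v; lra. }
    assert (P : v j <= exp kappa * profile theta e a b (ln (INR A))).
    { unfold v; rewrite truncated_profile_in by lia.
      assert (L1 : ln (INR A) <= ln (INR (S j))) by (apply ln_INR_le; lia).
      assert (L2 : ln (INR (S j)) <= ln (INR m) + ln (INR A))
        by (rewrite <- ln_INR_mul by lia; apply ln_INR_le; nia).
      eapply Rle_trans.
      - apply (profile_compare _ _ _ _ (ln (INR A)) _ (ln (INR m))); auto.
        rewrite Rabs_left1; lra.
      - apply Rmult_le_compat_r; [lra|]. apply exp_le_exp; nra. }
    rewrite (indic_in (m * A)) by nia.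
    assert (exp (theta * ln (INR m)) * v j <=
            INR M * (exp kappa * profile theta e a b (ln (INR A))))
      by (apply Rmult_le_compat; lra).
    lra.
  - destruct (Nat.lt_ge_cases (j / m) B) as [SB|SB].
    2:{ unfold v; rewrite !truncated_profile_out by lia.
        rewrite Rmult_0_r, Rminus_0_r, Rabs_R0; fold v; lra. }
    destruct (Nat.lt_ge_cases j B) as [JB|JB].
    (* Interior: each side is at most [exp kappa] times the other. *)
    + assert (I : Rabs (v (j / m)%nat - exp (theta * ln (INR m)) * v j) <=
                  (exp kappa - 1) * (exp (theta * ln (INR m)) * v j)).
      { unfold v; rewrite !truncated_profile_in by lia.
        set (y := ln (INR (S (j / m)))) in *; set (x := ln (INR (S j))) in *.
        assert (Hx : INR m / INR (S j) <= kappa / 2).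
        { apply Rle_div_l; [apply lt_0_INR; lia|].
          apply Rle_trans with (INR M); [apply le_INR; lia|].
          eapply Rle_trans; [exact HkA|].
          apply Rmult_le_compat_l; [lra|apply le_INR; lia]. }
        assert (U : profile theta e a b y <=
                    exp kappa * (exp (theta * ln (INR m)) * profile theta e a b x)).
        { eapply Rle_trans.
          - apply (profile_compare _ _ _ _ x _ (ln (INR m))); auto.
            rewrite Rabs_pos_eq; lra.
          - rewrite <- Rmult_assoc, <- exp_plus.
            apply Rmult_le_compat_r; [left; apply exp_pos|].
            apply exp_le_exp.
            assert (theta * (x - y) <= theta * ln (INR m))
              by (apply Rmult_le_compat_l; lra).
            lra. }
        assert (L : exp (theta * ln (INR m)) * profile theta e a b x <=
                    exp kappa * profile theta e a b y).
        { eapply Rle_trans.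
          - apply Rmult_le_compat_l; [lra|].
            apply (profile_compare _ _ _ _ y _ (ln (INR m))); auto.
            rewrite Rabs_left1; lra.
          - rewrite <- Rmult_assoc, <- exp_plus.
            apply Rmult_le_compat_r; [left; apply exp_pos|].
            apply exp_le_exp.
            assert (theta * (ln (INR m) + (y - x)) <= 1 * (kappa / 2)).
            { apply Rle_trans with (theta * (kappa / 2)).
              - apply Rmult_le_compat_l; lra.
              - apply Rmult_le_compat_r; lra. }
            lra. }
        assert (0 < profile theta e a b y) by apply exp_pos.
        assert (0 < profile theta e a b x) by apply exp_pos.
        apply Rabs_le; split; nra. }
      eapply Rle_trans; [exact I|].
      assert ((exp kappa - 1) * (exp (theta * ln (INR m)) * v j) <=
              (exp kappa - 1) * (INR M * v j)).
      { apply Rmult_le_compat_l; [lra|]. apply Rmult_le_compat_r; lra. }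
      lra.
    (* Right edge: only [v (j / m)] survives, and [j] < [m * B]. *)
    + assert (E0 : v j = 0) by (apply truncated_profile_out; lia).
      rewrite E0 in *.
      rewrite Rmult_0_r, Rminus_0_r, Rabs_pos_eq by apply truncated_profile_nonneg.
      assert (P : v (j / m)%nat <= INR M * exp kappa * profile theta e a b (ln (INR B))).
      { unfold v; rewrite truncated_profile_in by lia.
        set (y := ln (INR (S (j / m)))) in *.
        assert (L1 : ln (INR B) <= y + ln (INR m)).
        { eapply Rle_trans; [|exact D1]; apply ln_INR_le; lia. }
        assert (L2 : y <= ln (INR B)) by (apply ln_INR_le; lia).
        eapply Rle_trans.
        - apply (profile_compare _ _ _ _ (ln (INR B)) _ (ln (INR m))); auto.
          rewrite Rabs_pos_eq; lra.
        - apply Rmult_le_compat_r; [lra|].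
          rewrite <- (exp_ln_INR M) at 1 by lia; rewrite <- exp_plus.
          apply exp_le_exp.
          assert (theta * (ln (INR B) - y) <= theta * ln (INR m))
            by (apply Rmult_le_compat_l; lra).
          lra. }
      rewrite (indic_in (m * B)) by nia; lra.
Qed.

Section Eigenvector.
Context (X : rseq -> Prop) (nX : rseq -> R).
Context (HX : is_symmetric_seq_space X nX) (H1 : X (indic 1)).

(** The window [A, 2A) has the right cardinality and, unlike [0, A), can lie inside the support of a
    truncated profile. *)
Lemma fund_le_norm v c A :
  X v -> 0 <= c -> (forall j, (A <= j < 2 * A)%nat -> c <= v j) ->
  c * fund nX A <= nX v.
Proof.
  intros Hv Hc H; unfold fund.
  replace (c * nX (indic A)) with (nX (sscal c (indic A))).
  - apply (X_dom _ _ HX v _ (fun j => j + A)%nat); auto.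
    + intros j; unfold sscal, indic; destruct (Nat.ltb_spec j A); [|lra]; intros _.
      specialize (H (j + A)%nat ltac:(lia)).
      rewrite !Rabs_pos_eq; lra.
    + intros; lia.
  - rewrite (nX_scal _ _ HX), Rabs_pos_eq; auto. eapply X_indic; eauto.
Qed.

Lemma truncated_profile_mass theta e a b A B C :
  0 <= theta <= 1 -> 0 <= e <= 1 -> (1 <= C)%nat -> (A <= C)%nat -> (2 * C <= B)%nat ->
  profile theta e a b (ln (INR C)) * fund nX C <=
  4 * nX (truncated_profile theta e a b A B).
Proof.
  intros Ht He HC HAC HCB.
  assert (P : 0 < profile theta e a b (ln (INR C))) by apply exp_pos.
  enough (profile theta e a b (ln (INR C)) / 4 * fund nX C <=
          nX (truncated_profile theta e a b A B)) by lra.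
  apply fund_le_norm.
  - eapply X_finite with (n := B); eauto; intros; apply truncated_profile_out; lia.
  - lra.
  - intros j Hj; rewrite truncated_profile_in by lia.
    assert (L1 : ln (INR C) <= ln (INR (S j))) by (apply ln_INR_le; lia).
    assert (L2 : ln (INR (S j)) <= ln 2 + ln (INR C)).
    { replace 2 with (INR 2) by (simpl; ring).
      rewrite <- ln_INR_mul by lia; apply ln_INR_le; lia. }
    pose proof (profile_compare theta e a b (ln (INR (S j))) (ln (INR C)) (ln 2)) as Hc.
    rewrite Rabs_pos_eq in Hc by lra.
    specialize (Hc ltac:(lra) ltac:(lra)).
    (* Across a window [C, 2C) the power costs at most 2^theta and the weight at most 2^e. *)
    assert (Hq : exp (theta * (ln (INR (S j)) - ln (INR C)) + e * ln 2) <= 4).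
    { replace 4 with (exp (ln 2 + ln 2)) by (rewrite exp_plus, exp_ln; lra).
      apply exp_le_exp; apply Rplus_le_compat; nra. }
    assert (0 < profile theta e a b (ln (INR (S j)))) by apply exp_pos.
    assert (exp (theta * (ln (INR (S j)) - ln (INR C)) + e * ln 2) *
            profile theta e a b (ln (INR (S j))) <=
            4 * profile theta e a b (ln (INR (S j))))
      by (apply Rmult_le_compat_r; lra).
    lra.
Qed.

(* [v j = w j * (j + 1) ^ (- theta)] on [[A, B)], where [w] is constant on
   [[A', B']] and behaves like a power [e], resp. [- e], to the left, resp.
   right, of it; [A' = A n] and [B = B' n'] are far enough apart for the growth of
   the fundamental function, tilted by [w], to make the truncation errors at
   [A] and [B] negligible. *)
Lemma almost_eigenvector theta M eta :
  0 <= theta <= 1 -> fund_mu nX <= theta <= fund_nu nX -> 0 < eta ->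
  exists (v : rseq) (B : nat),
    (1 <= B)%nat /\ (forall j, (B <= j)%nat -> v j = 0) /\
    (forall j, 0 <= v j) /\ X v /\ nX v = 1 /\
    forall m, (1 <= m <= M)%nat ->
      nX (ssub (dil m v) (sscal (exp (theta * ln (INR m))) v)) <= eta.
Proof.
  intros Ht Hmn Heta.
  (* For [M] = 0 any unit vector will do; the constants below divide by [INR M]. *)
  destruct (Nat.eq_dec M 0) as [->|HM0].
  { assert (F1 : 0 < fund nX 1) by (eapply fund_pos; eauto).
    exists (sscal (/ fund nX 1) (indic 1)), 1%nat; repeat split.
    - lia.
    - intros j Hj; unfold sscal, indic; destruct (Nat.ltb_spec j 1); [lia|ring].
    - intros j; apply Rmult_le_pos; [left; apply Rinv_0_lt_compat; auto|apply indic_nonneg].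
    - eapply X_scal; eauto.
    - rewrite (nX_scal _ _ HX) by auto.
      rewrite Rabs_pos_eq by (left; apply Rinv_0_lt_compat; auto).
      apply Rinv_l; unfold fund in F1 |- *; lra.
    - intros; lia. }
  assert (HM : 1 <= INR M) by (apply (le_INR 1); lia).
  (* Chosen so that the interior error (E - 1) M equals [eta / 3]. *)
  set (E := 1 + eta / (3 * INR M)).
  assert (HE : 1 < E) by (unfold E; assert (0 < eta / (3 * INR M)) by (apply Rdiv_lt_0_compat; lra); lra).
  set (kappa := ln E).
  assert (Ek : exp kappa = E) by (apply exp_ln; lra).
  assert (Hk : 0 < kappa) by (unfold kappa; rewrite <- ln_1; apply ln_increasing; lra).
  assert (HlM : 0 <= ln (INR M)) by (apply ln_INR_nonneg; lia).
  (* Small enough for [e * ln M <= kappa / 2]; the summand 1 avoids a zero denominator at [M] = 1,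
     and [e <= 1] is needed for the mass estimate. *)
  set (e := Rmin 1 (kappa / (2 * (1 + ln (INR M))))).
  assert (He : 0 < e <= 1).
  { unfold e; split; [|apply Rmin_l].
    apply Rmin_glb_lt; [lra|apply Rdiv_lt_0_compat; lra]. }
  assert (HeM : e * ln (INR M) <= kappa / 2).
  { apply Rle_trans with (kappa / (2 * (1 + ln (INR M))) * (1 + ln (INR M))).
    - apply Rmult_le_compat; try lra. apply Rmin_r.
    - right; field; lra. }
  (* Each edge will contribute M E (M 4 tau) = [eta / 6]. One [M] is the factor in the pointwise
     bound, the other comes from the fundamental function at m A or m B, and 4 from the mass
     estimate. *)
  set (tau := eta / (24 * INR M * INR M * E)).
  assert (HME : 0 < 24 * INR M * INR M * E) by (repeat apply Rmult_lt_0_compat; lra).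
  assert (Htau : 0 < tau) by (apply Rdiv_lt_0_compat; auto).
  destruct (INR_unbounded (2 * INR M / kappa)) as [A0 HA0].
  destruct (ln_INR_unbounded (- ln tau / (e / 2))) as [N0 HN0].
  assert (Hsmall : forall n, (N0 <= n)%nat -> exp (- (e / 2) * ln (INR n)) <= tau).
  { intros n Hn; rewrite <- (exp_ln tau) by auto; apply exp_le_exp.
    specialize (HN0 n Hn); apply Rle_div_l in HN0; lra. }
  (* [A] > [A0] makes the discretisation error small, and n >= [N0] gives n^(-e/2) <= [tau]. *)
  destruct (fund_growth X nX HX H1 theta (e / 2) (A0 + 1) (N0 + 2))
    as (n & A & Hn & HA & G1); [lra|lra|lia|].
  (* The scale is taken at least [A * n], so that A' <= B'; n' >= 2 leaves room for the windows [A',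
     2A') and [B', 2B') below [B]. *)
  destruct (fund_decay X nX HX H1 theta (e / 2) (A * n) (N0 + 2))
    as (n' & B' & Hn' & HB' & G2); [lra|lra|nia|].
  set (A' := (A * n)%nat) in *; set (B := (B' * n')%nat) in *.
  assert (HA1 : (1 <= A)%nat) by lia.
  assert (HA'1 : (1 <= A')%nat) by (unfold A'; nia).
  assert (HB1 : (1 <= B)%nat) by (unfold B; nia).
  set (a := ln (INR A')); set (b := ln (INR B')).
  assert (Hab : a <= b) by (apply ln_INR_le; auto).
  assert (EA' : a = ln (INR A) + ln (INR n)) by (apply ln_INR_mul; lia).
  assert (EB : ln (INR B) = b + ln (INR n')) by (apply ln_INR_mul; lia).
  set (v := truncated_profile theta e a b A B).
  set (P := profile theta e a b).
  assert (Xv : X v).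
  { eapply X_finite with (n := B); eauto; intros; apply truncated_profile_out; lia. }
  assert (FA : 0 < fund nX A) by (eapply fund_pos; eauto).
  assert (FB' : 0 < fund nX B') by (eapply fund_pos; eauto; lia).
  assert (MA : P a * fund nX A' <= 4 * nX v)
    by (apply truncated_profile_mass; try lra; unfold A', B in *; nia).
  assert (MB : P b * fund nX B' <= 4 * nX v)
    by (apply truncated_profile_mass; try lra; unfold A', B in *; nia).
  assert (Pa : P a = exp (- (theta * a))).
  { unfold P, profile, dist_interval; f_equal.
    replace (Rmax 0 (Rmax (a - a) (a - b))) with 0; [ring|].
    unfold Rmax; repeat destruct Rle_dec; lra. }
  assert (Pb : P b = exp (- (theta * b))).
  { unfold P, profile, dist_interval; f_equal.
    replace (Rmax 0 (Rmax (a - b) (b - b))) with 0; [ring|].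
    unfold Rmax; repeat destruct Rle_dec; lra. }
  (* From A' down to [A] the weight gives n^(-e), while the growth estimate concedes n^(e/2); the
     net n^(-e/2) is at most [tau], and [MA] closes the chain. *)
  assert (SA : P (ln (INR A)) * fund nX A <= 4 * tau * nX v).
  { apply Rle_trans with (tau * (P a * fund nX A')); [|nra].
    apply Rle_trans with
      (tau * (P a * (fund nX A * exp ((theta - e / 2) * ln (INR n))))).
    2:{ apply Rmult_le_compat_l; [lra|]. apply Rmult_le_compat_l; [left; apply exp_pos|auto]. }
    replace (tau * (P a * (fund nX A * exp ((theta - e / 2) * ln (INR n)))))
      with (tau * (P a * exp ((theta - e / 2) * ln (INR n))) * fund nX A) by ring.
    apply Rmult_le_compat_r; [lra|].
    eapply Rle_trans; [|apply Rmult_le_compat_r; [|apply (Hsmall n); lia]].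
    2:{ left; apply Rmult_lt_0_compat; apply exp_pos. }
    rewrite Pa, <- !exp_plus; unfold P, profile; apply exp_le_exp.
    assert (D : ln (INR n) <= dist_interval a b (ln (INR A))).
    { unfold dist_interval; eapply Rle_trans; [|apply Rmax_r].
      eapply Rle_trans; [|apply Rmax_l]; lra. }
    assert (e * ln (INR n) <= e * dist_interval a b (ln (INR A)))
      by (apply Rmult_le_compat_l; lra).
    replace (theta * a) with (theta * ln (INR A) + theta * ln (INR n))
      by (rewrite EA'; ring).
    lra. }
  assert (SB : P (ln (INR B)) * fund nX B <= 4 * tau * nX v).
  { apply Rle_trans with (tau * (P b * fund nX B')); [|nra].
    apply Rle_trans with
      (P (ln (INR B)) * (fund nX B' * exp ((theta + e / 2) * ln (INR n')))).
    { apply Rmult_le_compat_l; [left; apply exp_pos|auto]. }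
    rewrite (Rmult_comm (fund nX B')), <- !Rmult_assoc.
    apply Rmult_le_compat_r; [lra|].
    eapply Rle_trans; [|apply Rmult_le_compat_r; [|apply (Hsmall n'); lia]].
    2:{ left; apply exp_pos. }
    rewrite Pb, <- !exp_plus; unfold P, profile; rewrite <- exp_plus; apply exp_le_exp.
    assert (D : ln (INR n') <= dist_interval a b (ln (INR B))).
    { unfold dist_interval; eapply Rle_trans; [|apply Rmax_r].
      eapply Rle_trans; [|apply Rmax_r]; lra. }
    assert (e * ln (INR n') <= e * dist_interval a b (ln (INR B)))
      by (apply Rmult_le_compat_l; lra).
    replace (theta * ln (INR B)) with (theta * b + theta * ln (INR n'))
      by (rewrite EB; ring).
    lra. }
  assert (Nv : 0 < nX v).
  { assert (0 < P b * fund nX B') by (apply Rmult_lt_0_compat; auto; apply exp_pos).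
    lra. }
  assert (Iv : 0 < / nX v) by (apply Rinv_0_lt_compat; auto).
  exists (sscal (/ nX v) v), B; repeat split.
  - exact HB1.
  - intros j Hj; unfold sscal, v; rewrite truncated_profile_out by lia; ring.
  - intros j; apply Rmult_le_pos; [lra|apply truncated_profile_nonneg].
  - eapply X_scal; eauto.
  - rewrite (nX_scal _ _ HX), Rabs_pos_eq by (auto; lra). apply Rinv_l; lra.
  - intros m Hm.
    set (c := exp (theta * ln (INR m))).
    set (D := ssub (dil m v) (sscal c v)).
    replace (ssub (dil m (sscal (/ nX v) v)) (sscal c (sscal (/ nX v) v)))
      with (sscal (/ nX v) D).
    2:{ apply functional_extensionality; intros j; unfold D, ssub, sscal, dil.
        destruct (Nat.eqb m 0); ring. }
    set (kA := INR M * exp kappa * P (ln (INR A))).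
    set (kB := INR M * exp kappa * P (ln (INR B))).
    assert (PA : 0 < P (ln (INR A))) by apply exp_pos.
    assert (PB : 0 < P (ln (INR B))) by apply exp_pos.
    assert (kA0 : 0 <= kA) by (unfold kA; rewrite Ek; repeat apply Rmult_le_pos; lra).
    assert (kB0 : 0 <= kB) by (unfold kB; rewrite Ek; repeat apply Rmult_le_pos; lra).
    assert (k0 : 0 <= (exp kappa - 1) * INR M) by (rewrite Ek; apply Rmult_le_pos; lra).
    set (u := sadd (sadd (sscal ((exp kappa - 1) * INR M) v)
                         (sscal kA (indic (m * A)))) (sscal kB (indic (m * B)))).
    assert (XI : forall k, X (indic k)) by (intros; eapply X_indic; eauto).
    assert (Xs : forall k x, X x -> X (sscal k x)) by (intros; eapply X_scal; eauto).
    assert (Xa : forall x y, X x -> X y -> X (sadd x y)) by (intros; eapply X_add; eauto).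
    assert (Xu : X u) by (unfold u; auto).
    assert (XD : X D) by (unfold D; eapply X_sub; eauto; eapply X_dil; eauto).
    assert (LD : nX D <= nX u).
    { eapply X_mono; eauto; intros j; eapply Rle_trans; [|apply Rle_abs].
      unfold D, ssub, sscal, dil, u, sadd; destruct (Nat.eqb_spec m 0); [lia|].
      apply truncated_profile_dilation; auto; try lra.
      apply le_INR in HA; rewrite plus_INR in HA; simpl in HA.
      apply Rle_trans with (kappa / 2 * (2 * INR M / kappa)).
      - right; field; lra.
      - apply Rmult_le_compat_l; lra. }
    assert (Lf : forall k, fund nX (m * k) <= INR M * fund nX k).
    { intros k; rewrite Nat.mul_comm.
      eapply Rle_trans; [eapply fund_mul; eauto; lia|].
      apply Rmult_le_compat_r; [eapply nX_pos; eauto; apply XI|apply le_INR; lia]. }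
    assert (Lu : nX u <= (exp kappa - 1) * INR M * nX v
                 + kA * (INR M * fund nX A) + kB * (INR M * fund nX B)).
    { unfold u; eapply Rle_trans; [eapply nX_add; eauto|].
      apply Rplus_le_compat; [eapply Rle_trans; [eapply nX_add; eauto|];
        apply Rplus_le_compat|];
        rewrite (nX_scal _ _ HX), Rabs_pos_eq; auto; try lra;
        apply Rmult_le_compat_l; auto; apply Lf. }
    rewrite (nX_scal _ _ HX), Rabs_pos_eq by (auto; lra).
    rewrite Rmult_comm; apply Rle_div_l; auto.
    unfold kA, kB in Lu; rewrite Ek in Lu.
    assert (Q : INR M * INR M * E * (8 * tau) = eta / 3) by (unfold tau; field; lra).
    assert (Q' : (E - 1) * INR M = eta / 3) by (unfold E; field; lra).
    rewrite Q' in Lu.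
    assert (K : 0 <= INR M * INR M * E) by (repeat apply Rmult_le_pos; lra).
    apply (Rmult_le_compat_l _ _ _ K) in SA.
    apply (Rmult_le_compat_l _ _ _ K) in SB.
    apply (f_equal (fun z => z * nX v)) in Q.
    assert (0 < eta * nX v) by (apply Rmult_lt_0_compat; auto).
    lra.
Qed.

End Eigenvector.

(** * Sufficiency *)

Definition exponent (p : Rbar) : R :=
  match p with Finite q => / q | _ => 0 end.

(** The value 0 at [m] = 0 matches [dil 0]; since [ln 0] is 0 here, the formula alone would give
    1. *)
Definition npow (theta : R) (m : nat) : R :=
  if Nat.eqb m 0 then 0 else exp (theta * ln (INR m)).

Lemma npow_pos theta m : (1 <= m)%nat -> npow theta m = exp (theta * ln (INR m)).
Proof. intros H; unfold npow; destruct (Nat.eqb_spec m 0); lia || reflexivity. Qed.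

Lemma npow_nonneg theta m : 0 <= npow theta m.
Proof. unfold npow; destruct (Nat.eqb m 0); [lra|left; apply exp_pos]. Qed.

Lemma INR_list_sum (f : nat -> nat) n :
  INR (list_sum (map f (seq 0 n))) = fsum (fun k => INR (f k)) n.
Proof.
  induction n as [|n IH]; [reflexivity|].
  rewrite seq_S, map_app, list_sum_app, plus_INR, IH; simpl.
  rewrite Nat.add_0_r; reflexivity.
Qed.

Lemma Forall2_map_seq (A : Type) (R0 : A -> A -> Prop) (f g : nat -> A) n :
  (forall k, (k < n)%nat -> R0 (f k) (g k)) ->
  Forall2 R0 (map f (seq 0 n)) (map g (seq 0 n)).
Proof.
  induction n as [|n IH]; intros H; [constructor|].
  rewrite seq_S, !map_app; apply Forall2_app; [auto|].
  repeat constructor; auto.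
Qed.

Lemma nth_map_seq (A : Type) (f : nat -> A) n d k :
  (k < n)%nat -> nth k (map f (seq 0 n)) d = f k.
Proof.
  intros H; rewrite (nth_indep _ d (f 0%nat)) by (rewrite length_map, length_seq; auto).
  rewrite map_nth, seq_nth; auto.
Qed.

Lemma fmaxabs_ge a n k : (k < n)%nat -> Rabs (a k) <= fmaxabs a n.
Proof.
  induction n as [|n IH]; intros H; [lia|]; simpl.
  destruct (Nat.eq_dec k n) as [->|E]; [apply Rmax_r|].
  eapply Rle_trans; [apply IH; lia|apply Rmax_l].
Qed.

Lemma fmaxabs_le a n c :
  0 <= c -> (forall k, (k < n)%nat -> Rabs (a k) <= c) -> fmaxabs a n <= c.
Proof. induction n as [|n IH]; intros Hc H; simpl; [auto|]; apply Rmax_lub; auto. Qed.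

Lemma powabs_pos x q : x <> 0 -> powabs x q = exp (q * ln (Rabs x)).
Proof. intros H; unfold powabs; destruct (Req_EM_T x 0); tauto. Qed.

Lemma powabs_zero q : powabs 0 q = 0.
Proof. unfold powabs; destruct (Req_EM_T 0 0); tauto || lra. Qed.

Lemma powabs_nonneg x q : 0 <= powabs x q.
Proof.
  destruct (Req_dec x 0) as [->|H]; [rewrite powabs_zero; lra|].
  rewrite powabs_pos by auto; left; apply exp_pos.
Qed.

Lemma fsum_eq_zero f n :
  (forall k, (k < n)%nat -> 0 <= f k) -> fsum f n = 0 ->
  forall k, (k < n)%nat -> f k = 0.
Proof.
  induction n as [|n IH]; intros H E k Hk; [lia|]; simpl in E.
  assert (0 <= fsum f n) by (apply fsum_nonneg; auto).
  assert (0 <= f n) by auto.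
  destruct (Nat.eq_dec k n) as [->|]; [lra|].
  apply IH; auto; [lra|lia].
Qed.

Section Representation.
Context (X : rseq -> Prop) (nX : rseq -> R).
Context (HX : is_symmetric_seq_space X nX) (H1 : X (indic 1)).

Definition scaled_copies (v : rseq) (a : nat -> R) (n : nat) : rseq :=
  merge (map (fun k => sscal (a k) v) (seq 0 n)).

Lemma X_copies_list v a n :
  X v -> List.Forall X (map (fun k => sscal (a k) v) (seq 0 n)).
Proof.
  intros Hv; apply Forall_forall; intros x Hx.
  apply in_map_iff in Hx; destruct Hx as [k [<- _]]; eapply X_scal; eauto.
Qed.

Lemma X_scaled_copies v a n : X v -> X (scaled_copies v a n).
Proof. intros Hv; apply (X_merge X nX HX), X_copies_list; auto. Qed.

Lemma scaled_copies_mono v a b n :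
  X v -> (forall k, (k < n)%nat -> Rabs (a k) <= Rabs (b k)) ->
  nX (scaled_copies v a n) <= nX (scaled_copies v b n).
Proof.
  intros Hv H; apply (merge_mono X nX HX); [apply X_copies_list; auto|].
  apply Forall2_map_seq; intros k Hk t; unfold sscal; rewrite !Rabs_mult.
  apply Rmult_le_compat_r; [apply Rabs_pos|auto].
Qed.

Lemma merge_single x : merge (x :: nil) = x.
Proof.
  apply functional_extensionality; intros j; unfold merge.
  change (length (x :: nil)) with 1%nat.
  rewrite Nat.mod_1_r, Nat.div_1_r; reflexivity.
Qed.

Lemma scaled_copies_scal v a b n :
  X v ->
  nX (scaled_copies v (fun k => b * a k) n) = Rabs b * nX (scaled_copies v a n).
Proof.
  intros Hv; rewrite <- (nX_scal _ _ HX) by (apply X_scaled_copies; auto); f_equal.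
  apply functional_extensionality; intros j.
  change (sscal b (scaled_copies v a n) j) with (b * scaled_copies v a n j).
  unfold scaled_copies, merge; rewrite !length_map, length_seq.
  destruct (Nat.lt_ge_cases (j mod n) n) as [L|L].
  - rewrite !nth_map_seq by auto; unfold sscal; ring.
  - rewrite !nth_overflow by (rewrite length_map, length_seq; auto).
    unfold szero; ring.
Qed.

Section Approx.
Context (theta : R) (M : nat) (eta : R) (v : rseq).
Context (Hv : X v) (Nv : nX v = 1) (Heta : 0 <= eta).
Context (Hdil : forall m, (1 <= m <= M)%nat ->
      nX (ssub (dil m v) (sscal (exp (theta * ln (INR m))) v)) <= eta).

Lemma dil_npow m : (m <= M)%nat -> nX (ssub (dil m v) (sscal (npow theta m) v)) <= eta.
Proof.
  intros Hm; destruct (Nat.eq_dec m 0) as [->|].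
  - replace (ssub _ _) with szero; [rewrite (nX_zero _ _ HX); auto|].
    apply functional_extensionality; intros j; unfold ssub, dil, sscal, npow, szero.
    simpl; ring.
  - rewrite npow_pos by lia; apply Hdil; lia.
Qed.

(** The only error is in passing from m^theta v to [dil m v]; from there to [m] copies the norm is
    unchanged. *)
Lemma merge_replace_one m ls :
  (m <= M)%nat -> List.Forall X ls ->
  Rabs (nX (merge (sscal (npow theta m) v :: ls)) - nX (merge (repeat v m ++ ls))) <= eta.
Proof.
  intros Hm HF; rewrite <- (merge_dil X nX HX) by auto.
  assert (Xd : X (dil m v)) by (eapply X_dil; eauto).
  assert (Xs : X (sscal (npow theta m) v)) by (eapply X_scal; eauto).
  pose proof (dil_npow m Hm) as D.
  assert (D' : nX (ssub (sscal (npow theta m) v) (dil m v)) <= eta).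
  { eapply Rle_trans; [|exact D]. eapply X_mono; eauto; [eapply X_sub; eauto|].
    intros j; unfold ssub; rewrite Rabs_minus_sym; lra. }
  pose proof (merge_perturb X nX HX _ _ ls Xd Xs HF).
  pose proof (merge_perturb X nX HX _ _ ls Xs Xd HF).
  apply Rabs_le; lra.
Qed.

(** [s] counts the copies already expanded, which is what the induction needs; each further member
    of [ms] costs [eta]. *)
Lemma merge_replace ms : forall s,
  (forall m, In m ms -> (m <= M)%nat) ->
  Rabs (nX (merge (map (fun m => sscal (npow theta m) v) ms ++ repeat v s))
        - nX (merge (repeat v (list_sum ms + s)))) <= INR (length ms) * eta.
Proof.
  induction ms as [|m ms IH]; intros s Hms.
  - simpl; rewrite Rminus_diag, Rabs_R0; lra.
  - assert (HF : List.Forall X (map (fun m => sscal (npow theta m) v) ms ++ repeat v s)).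
    { apply Forall_app; split; apply Forall_forall; intros x Hx.
      - apply in_map_iff in Hx; destruct Hx as [k [<- _]]; eapply X_scal; eauto.
      - apply repeat_spec in Hx; subst; auto. }
    pose proof (merge_replace_one m _ (Hms m (or_introl eq_refl)) HF) as A.
    rewrite (merge_perm X nX HX (repeat v m ++ _)
      (map (fun m => sscal (npow theta m) v) ms ++ repeat v (m + s))) in A.
    2:{ apply Forall_app; split; auto.
        apply Forall_forall; intros x Hx; apply repeat_spec in Hx; subst; auto. }
    2:{ rewrite repeat_app, Permutation_app_swap_app; reflexivity. }
    specialize (IH (m + s)%nat (fun k Hk => Hms k (or_intror Hk))).
    replace (list_sum (m :: ms) + s)%nat with (list_sum ms + (m + s))%nat
      by (simpl; lia).
    change (length (m :: ms)) with (S (length ms)); rewrite S_INR; simpl map; simpl app.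
    match type of A with Rabs (?x - ?y) <= _ =>
      match type of IH with Rabs (_ - ?z) <= _ =>
        replace (x - z) with ((x - y) + (y - z)) by ring end end.
    eapply Rle_trans; [apply Rabs_triang|lra].
Qed.

Lemma scaled_copies_npow (f : nat -> nat) n :
  (list_sum (map f (seq 0 n)) <= M)%nat ->
  Rabs (nX (scaled_copies v (fun k => npow theta (f k)) n)
        - npow theta (list_sum (map f (seq 0 n)))) <= (INR n + 1) * eta.
Proof.
  intros Hs; set (ms := map f (seq 0 n)) in *.
  assert (Hms : forall m, In m ms -> (m <= M)%nat).
  { intros m Hm; eapply Nat.le_trans; [|exact Hs].
    clear Hs; induction ms as [|m' ms IH]; simpl in *; [tauto|].
    destruct Hm as [->|Hm]; [lia|apply IH in Hm; lia]. }
  pose proof (merge_replace ms 0%nat Hms) as A.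
  rewrite Nat.add_0_r in A; simpl repeat in A; rewrite app_nil_r in A.
  unfold ms in A at 1 3; rewrite map_map, length_map, length_seq in A.
  (* One more replacement, read backwards, gathers all the copies into a single multiple of [v]:
     hence [n + 1] errors. *)
  pose proof (merge_replace_one (list_sum ms) nil Hs (List.Forall_nil _)) as B.
  rewrite app_nil_r, merge_single, (nX_scal _ _ HX), Nv, (Rabs_pos_eq (npow _ _)), Rmult_1_r in B
    by (auto; apply npow_nonneg).
  fold (scaled_copies v (fun k => npow theta (f k)) n) in A.
  rewrite Rabs_minus_sym in B.
  match type of A with Rabs (?x - ?y) <= _ =>
    match type of B with Rabs (_ - ?z) <= _ =>
      replace (x - z) with ((x - y) + (y - z)) by ring end end.
  eapply Rle_trans; [apply Rabs_triang|lra].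
Qed.

(* With [|a k| ^ q] close to [S m_k / N], the [k]-th copy of [v] is replaced by
   [m_k] copies, so that everything reduces to [sum m_k ~ N] equal copies. *)
Lemma scaled_copies_lp q n N kappa a :
  1 <= q -> theta = / q -> (1 <= N)%nat -> (N + n <= M)%nat ->
  INR n <= kappa * INR N -> (INR n + 1) * eta <= kappa ->
  (1 - 2 * kappa) * lp_norm (Finite q) n a <= nX (scaled_copies v a n) <=
  (1 + 2 * kappa) * lp_norm (Finite q) n a.
Proof.
  intros Hq Htheta HN HM Hn He.
  assert (Ht : 0 < theta <= 1).
  { rewrite Htheta; split; [apply Rinv_0_lt_compat; lra|].
    rewrite <- Rinv_1; apply Rinv_le_contravar; lra. }
  assert (Htq : theta * q = 1) by (rewrite Htheta; field; lra).
  unfold lp_norm; set (S := fsum (fun k => powabs (a k) q) n).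
  assert (HS : 0 <= S) by (apply fsum_nonneg; intros; apply powabs_nonneg).
  rewrite <- Htheta.
  destruct (Req_dec S 0) as [E|E].
  { assert (Z : forall k, (k < n)%nat -> a k = 0).
    { intros k Hk; apply NNPP; intros Hne.
      assert (E0 : powabs (a k) q = 0).
      { apply (fsum_eq_zero (fun k => powabs (a k) q) n); auto.
        intros; apply powabs_nonneg. }
      rewrite powabs_pos in E0 by auto.
      pose proof (exp_pos (q * ln (Rabs (a k)))); lra. }
    rewrite E, powabs_zero, !Rmult_0_r.
    pose proof (scaled_copies_mono v a (fun _ => 0 * 0) n Hv) as U.
    rewrite scaled_copies_scal, Rabs_R0, !Rmult_0_l in U by auto.
    split; [eapply nX_pos; eauto; apply X_scaled_copies; auto|].
    apply U; intros k Hk; rewrite Z by auto; lra. }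
  rewrite powabs_pos, Rabs_pos_eq by auto.
  set (L := exp (theta * ln S)).
  assert (HL : 0 < L) by apply exp_pos.
  assert (HN1 : 1 <= INR N) by (apply (le_INR 1); auto).
  assert (Hkap : 0 <= kappa).
  { pose proof (pos_INR n). apply Rmult_le_reg_r with (INR N); lra. }
  (* The ideal multiplicities, of total [N]; [f] rounds them down. *)
  set (y := fun k => INR N * powabs (a k) q / S).
  assert (Hy : forall k, 0 <= y k).
  { intros k; unfold y, Rdiv; apply Rmult_le_pos.
    - apply Rmult_le_pos; [lra|apply powabs_nonneg].
    - left; apply Rinv_0_lt_compat; lra. }
  set (f := fun k => proj1_sig (nfloor_ex (y k) (Hy k))).
  assert (Hf : forall k, INR (f k) <= y k < INR (f k) + 1)
    by (intros k; unfold f; destruct nfloor_ex; auto).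
  assert (Sy : fsum y n = INR N).
  { unfold y; rewrite (fsum_ext _ (fun k => INR N / S * powabs (a k) q)).
    - rewrite fsum_scal; fold S; field; lra.
    - intros; field; lra. }
  (* b = (S / N)^theta, so that b y_k^theta = |a_k|, as theta q = 1. Rounding then sandwiches |a_k|
     between b f(k)^theta and b (f(k) + 1)^theta. *)
  set (b := exp (theta * (ln S - ln (INR N)))).
  assert (Hb : 0 < b) by apply exp_pos.
  assert (HlN : 0 <= ln (INR N)) by (apply ln_INR_nonneg; auto).
  assert (HbL : b <= L) by (apply exp_le_exp, Rmult_le_compat_l; lra).
  assert (Elny : forall k, a k <> 0 ->
            ln (y k) = ln (INR N) + q * ln (Rabs (a k)) - ln S).
  { intros k Hk; unfold y; rewrite powabs_pos by auto.
    pose proof (exp_pos (q * ln (Rabs (a k)))).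
    rewrite ln_div, ln_mult, ln_exp; try lra.
    apply Rmult_lt_0_compat; lra. }
  assert (Eexp : forall k, a k <> 0 -> exp (theta * (ln S - ln (INR N)) + theta * ln (y k)) = Rabs (a k)).
  { intros k Hk; rewrite Elny by auto.
    replace (_ + _) with (theta * q * ln (Rabs (a k))) by ring.
    rewrite Htq, Rmult_1_l, exp_ln; auto; apply Rabs_pos_lt; auto. }
  assert (Y0 : forall k, a k = 0 -> y k = 0)
    by (intros k Hk; unfold y; rewrite Hk, powabs_zero; field; lra).
  assert (Lo : forall k, b * npow theta (f k) <= Rabs (a k)).
  { intros k; unfold npow; destruct (Nat.eqb_spec (f k) 0) as [E0|E0].
    - rewrite Rmult_0_r; apply Rabs_pos.
    - assert (F1 : 1 <= INR (f k)) by (apply (le_INR 1); lia).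
      assert (Hk : a k <> 0) by (intros Z; apply Y0 in Z; specialize (Hf k); lra).
      rewrite <- (Eexp k Hk); unfold b; rewrite <- exp_plus; apply exp_le_exp.
      apply Rplus_le_compat_l, Rmult_le_compat_l; [lra|].
      apply ln_le; [lra|apply Hf]. }
  assert (Up : forall k, Rabs (a k) <= b * npow theta (f k + 1)).
  { intros k; destruct (Req_dec (a k) 0) as [Z|Hk].
    - rewrite Z, Rabs_R0; apply Rmult_le_pos; [lra|apply npow_nonneg].
    - rewrite npow_pos by lia; rewrite <- (Eexp k Hk); unfold b; rewrite <- exp_plus.
      apply exp_le_exp, Rplus_le_compat_l, Rmult_le_compat_l; [lra|].
      assert (0 < y k).
      { destruct (Hy k) as [|Z]; auto; exfalso; apply Hk.
        unfold y in Z; rewrite powabs_pos in Z by auto.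
        assert (0 < INR N * exp (q * ln (Rabs (a k))) / S); [|lra].
        apply Rdiv_lt_0_compat; [|lra].
        apply Rmult_lt_0_compat; [lra|apply exp_pos]. }
      apply ln_le; auto. rewrite plus_INR; specialize (Hf k); simpl; lra. }
  (* Totals after rounding down and up: N - n <= T <= N and T' = T + n <= N + n, whence the
     requirement N + n <= M. *)
  set (T := list_sum (map f (seq 0 n))).
  set (T' := list_sum (map (fun k => (f k + 1)%nat) (seq 0 n))).
  assert (ET : INR T <= INR N <= INR T + INR n).
  { unfold T; rewrite INR_list_sum, <- Sy; split.
    - apply fsum_le; intros; apply Hf.
    - replace (INR n) with (fsum (fun _ => 1) n) by (rewrite fsum_const; ring).
      apply Rle_trans with (fsum (fun k => INR (f k) + 1) n).
      + apply fsum_le; intros k _; specialize (Hf k); lra.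
      + rewrite fsum_plus; lra. }
  assert (ET' : INR T' = INR T + INR n).
  { unfold T, T'; rewrite !INR_list_sum.
    rewrite (fsum_ext _ (fun k => INR (f k) + 1)) by (intros; rewrite plus_INR; reflexivity).
    rewrite fsum_plus, fsum_const; ring. }
  assert (HTN : (T <= N)%nat) by (apply INR_le; lra).
  assert (HT' : (T' <= N + n)%nat) by (apply INR_le; rewrite plus_INR; lra).
  pose proof (scaled_copies_npow f n ltac:(fold T; lia)) as A.
  pose proof (scaled_copies_npow (fun k => (f k + 1)%nat) n ltac:(fold T'; lia)) as A'.
  fold T in A; fold T' in A'.
  apply Rabs_le_between in A; apply Rabs_le_between in A'.
  assert (Hbe : b * ((INR n + 1) * eta) <= L * kappa).
  { apply Rmult_le_compat; lra. }
  assert (HnN : L * (INR n / INR N) <= L * kappa).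
  { apply Rmult_le_compat_l; [lra|]. apply Rle_div_l; lra. }
  split.
  - apply Rle_trans with (nX (scaled_copies v (fun k => b * npow theta (f k)) n)).
    2:{ apply scaled_copies_mono; auto; intros k _.
        rewrite Rabs_pos_eq; auto; apply Rmult_le_pos; [lra|apply npow_nonneg]. }
    rewrite scaled_copies_scal, Rabs_pos_eq by (auto; lra).
    (* (T / N)^theta >= T / N because T <= N and theta <= 1. *)
    assert (B : L * (INR T / INR N) <= b * npow theta T).
    { unfold npow; destruct (Nat.eqb_spec T 0) as [->|E0].
      - simpl; unfold Rdiv; rewrite !Rmult_0_l, !Rmult_0_r; lra.
      - assert (T1 : 1 <= INR T) by (apply (le_INR 1); lia).
        unfold L, b; rewrite <- exp_plus.
        replace (INR T / INR N) with (exp (ln (INR T) - ln (INR N))).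
        2:{ rewrite <- ln_div, exp_ln; try lra. apply Rdiv_lt_0_compat; lra. }
        rewrite <- exp_plus; apply exp_le_exp.
        assert (ln (INR T) <= ln (INR N)) by (apply ln_le; lra).
        assert ((1 - theta) * (ln (INR T) - ln (INR N)) <= 0) by nra.
        lra. }
    assert (b * (npow theta T - (INR n + 1) * eta) <=
            b * nX (scaled_copies v (fun k => npow theta (f k)) n))
      by (apply Rmult_le_compat_l; lra).
    assert (L * (1 - INR n / INR N) <= L * (INR T / INR N)).
    { apply Rmult_le_compat_l; [lra|].
      replace (1 - INR n / INR N) with ((INR N - INR n) / INR N) by (field; lra).
      apply Rmult_le_compat_r; [left; apply Rinv_0_lt_compat; lra|lra]. }
    lra.
  - apply Rle_trans with (nX (scaled_copies v (fun k => b * npow theta (f k + 1)) n)).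
    { apply scaled_copies_mono; auto; intros k _.
      rewrite (Rabs_pos_eq (b * _)); auto.
      apply Rmult_le_pos; [lra|apply npow_nonneg]. }
    rewrite scaled_copies_scal, Rabs_pos_eq by (auto; lra).
    (* (T' / N)^theta <= ((N + n) / N)^theta <= 1 + n / N. *)
    assert (B : b * npow theta T' <= L * (1 + INR n / INR N)).
    { unfold npow; destruct (Nat.eqb_spec T' 0) as [E0|E0].
      - rewrite Rmult_0_r; apply Rmult_le_pos; [lra|].
        assert (0 <= INR n / INR N); [|lra].
        apply Rmult_le_pos; [apply pos_INR|left; apply Rinv_0_lt_compat; lra].
      - assert (T1 : 1 <= INR T') by (apply (le_INR 1); lia).
        pose proof (pos_INR n).
        unfold L, b; rewrite <- exp_plus.
        replace (1 + INR n / INR N) with (exp (ln (INR N + INR n) - ln (INR N))).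
        2:{ rewrite <- ln_div, exp_ln; try lra; [field; lra|].
            apply Rdiv_lt_0_compat; lra. }
        rewrite <- exp_plus; apply exp_le_exp.
        assert (ln (INR T') <= ln (INR N + INR n)) by (apply ln_le; lra).
        assert (ln (INR N) <= ln (INR N + INR n)) by (apply ln_le; lra).
        assert (theta * ln (INR T') <= theta * ln (INR N + INR n))
          by (apply Rmult_le_compat_l; lra).
        assert (0 <= (1 - theta) * (ln (INR N + INR n) - ln (INR N)))
          by (apply Rmult_le_pos; lra).
        lra. }
    assert (b * nX (scaled_copies v (fun k => npow theta (f k + 1)) n) <=
            b * (npow theta T' + (INR n + 1) * eta))
      by (apply Rmult_le_compat_l; lra).
    lra.
Qed.

(** A single summand gives the lower bound. For the upper one all coefficients are raised to the
    maximum, and [n] equal copies are replaced by n^0 v = v. *)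
Lemma scaled_copies_linf n kappa a :
  theta = 0 -> (1 <= n <= M)%nat -> 2 * eta <= kappa ->
  fmaxabs a n <= nX (scaled_copies v a n) <= (1 + kappa) * fmaxabs a n.
Proof.
  intros Ht Hn He; split.
  - apply fmaxabs_le; [eapply nX_pos; eauto; apply X_scaled_copies; auto|].
    intros k Hk.
    rewrite <- (Rmult_1_r (Rabs (a k))), <- Nv, <- (nX_scal _ _ HX) by auto.
    apply (X_dom X nX HX (scaled_copies v a n) _ (fun t => t * n + k)%nat).
    + apply X_scaled_copies; auto.
    + intros t _; unfold scaled_copies.
      pose proof (merge_at (map (fun k => sscal (a k) v) (seq 0 n)) k t) as Hm.
      rewrite length_map, length_seq in Hm; rewrite Hm, nth_map_seq by auto; lra.
    + intros; nia.
  - set (m := fmaxabs a n).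
    assert (Hm : 0 <= m).
    { eapply Rle_trans; [apply Rabs_pos|apply (fmaxabs_ge a n 0); lia]. }
    apply Rle_trans with (nX (scaled_copies v (fun k => m * npow theta 1) n)).
    { apply scaled_copies_mono; auto; intros k Hk.
      rewrite npow_pos, Ht, Rmult_0_l, exp_0, Rmult_1_r, (Rabs_pos_eq m) by lia || auto.
      apply fmaxabs_ge; auto. }
    rewrite scaled_copies_scal, Rabs_pos_eq, Rmult_comm by auto.
    apply Rmult_le_compat_r; auto.
    assert (A : nX (scaled_copies v (fun _ => npow theta 1) n) <= 1 + eta); [|lra].
    assert (Hr : scaled_copies v (fun _ => npow theta 1) n = merge (repeat v n ++ nil)).
    { unfold scaled_copies; rewrite app_nil_r; f_equal.
      replace (sscal (npow theta 1) v) with v.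
      - rewrite map_const, length_seq; reflexivity.
      - apply functional_extensionality; intros j; unfold sscal.
        rewrite npow_pos, Ht, Rmult_0_l, exp_0 by lia; ring. }
    rewrite Hr.
    pose proof (merge_replace_one n nil ltac:(lia) (List.Forall_nil _)) as B.
    rewrite merge_single, (nX_scal _ _ HX), Nv, npow_pos, Ht, Rmult_0_l, exp_0, Rabs_R1 in B
      by lia || auto.
    apply Rabs_le_between in B; lra.
Qed.

End Approx.

Lemma scaled_copies_estimate p n kappa :
  Rbar_le 1 p -> fund_mu nX <= exponent p <= fund_nu nX ->
  (1 <= n)%nat -> 0 < kappa < 1 ->
  exists (v : rseq) (B : nat),
    (1 <= B)%nat /\ (forall j, (B <= j)%nat -> v j = 0) /\ X v /\
    forall a, (1 - 2 * kappa) * lp_norm p n a <= nX (scaled_copies v a n) <=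
              (1 + 2 * kappa) * lp_norm p n a.
Proof.
  intros Hp Hmn Hn Hk.
  assert (Hn0 : 0 < INR n) by (apply lt_0_INR; lia).
  destruct (INR_unbounded (INR n / kappa)) as [N HN].
  assert (HnN : INR n <= kappa * INR N).
  { rewrite Rmult_comm; apply Rle_div_l; lra. }
  assert (HN1 : (1 <= N)%nat).
  { destruct N; [simpl in HnN; lra|lia]. }
  assert (Ht : 0 <= exponent p <= 1).
  { destruct p as [q| |]; simpl in *; try tauto; try lra.
    split; [left; apply Rinv_0_lt_compat; lra|].
    rewrite <- Rinv_1; apply Rinv_le_contravar; lra. }
  assert (He : 0 < kappa / (INR n + 1)) by (apply Rdiv_lt_0_compat; lra).
  (* [N + n] is the largest total multiplicity, and [kappa / (n + 1)] pays for [n + 1]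
     replacements. *)
  destruct (almost_eigenvector X nX HX H1 (exponent p) (N + n) _ Ht Hmn He)
    as (v & B & HB & Hv0 & _ & Xv & Nv & Hd).
  assert (Hke : (INR n + 1) * (kappa / (INR n + 1)) <= kappa) by (right; field; lra).
  assert (He' : kappa / (INR n + 1) <= kappa) by (apply Rle_div_l; nra).
  pose proof (Rlt_le _ _ He) as He0.
  exists v, B; do 3 (split; auto); intros a.
  destruct p as [q| |]; simpl in Hp; try tauto.
  - apply (scaled_copies_lp (/ q) (N + n) _ v Xv Nv He0 Hd q n N kappa a); auto.
  - destruct (scaled_copies_linf 0 (N + n) _ v Xv Nv He0 Hd n (2 * kappa) a)
      as [L U]; auto; try lia; try lra.
    split; [|exact U].
    eapply Rle_trans; [|exact L].
    assert (0 <= fmaxabs a n)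
      by (eapply Rle_trans; [apply Rabs_pos|apply (fmaxabs_ge a n 0); lia]).
    simpl; nra.
Qed.

(** * From interleaved copies to consecutive blocks *)

Lemma slincomb_blocks (v : rseq) B n a j :
  (1 <= B)%nat ->
  slincomb n a (fun k => block (fun k => k * B)%nat (fun i => v (i mod B)%nat) (S k)) j =
  if Nat.ltb (j / B) n then a (j / B)%nat * v (j mod B)%nat else 0.
Proof.
  intros HB; unfold slincomb.
  pose proof (Nat.mod_upper_bound j B ltac:(lia)).
  pose proof (divmod_eq j B ltac:(lia)).
  assert (Hb : forall k, block (fun k => k * B)%nat (fun i => v (i mod B)%nat) (S k) j =
                if Nat.eqb k (j / B) then v (j mod B)%nat else 0).
  { intros k; unfold block; simpl pred.
    destruct (Nat.leb_spec (k * B) j), (Nat.ltb_spec j (S k * B)),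
      (Nat.eqb_spec k (j / B)); simpl; try reflexivity; exfalso; nia. }
  destruct (Nat.ltb_spec (j / B) n) as [L|L].
  - rewrite (fsum_single _ _ (j / B)%nat L).
    + rewrite Hb, Nat.eqb_refl; reflexivity.
    + intros k _ Hk; rewrite Hb; destruct (Nat.eqb_spec k (j / B)); [tauto|ring].
  - apply fsum_zero; intros k Hk; rewrite Hb.
    destruct (Nat.eqb_spec k (j / B)); [lia|ring].
Qed.

(** Concatenation and interleaving differ by transposing the pair (copy, position): r B + t against
    t n + r. Finite support makes concatenation possible. *)
Lemma norm_slincomb_blocks (v : rseq) B n a :
  (1 <= B)%nat -> (1 <= n)%nat -> (forall j, (B <= j)%nat -> v j = 0) -> X v ->
  nX (slincomb n a (fun k => block (fun k => k * B)%nat (fun i => v (i mod B)%nat) (S k))) =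
  nX (scaled_copies v a n).
Proof.
  intros HB Hn Hv Xv.
  set (w := slincomb n a _).
  assert (Hw : forall j, w j = if Nat.ltb (j / B) n then a (j / B)%nat * v (j mod B)%nat else 0)
    by (intros; apply slincomb_blocks; auto).
  assert (Hc : forall r t, (r < n)%nat ->
                scaled_copies v a n (t * n + r)%nat = a r * v t).
  { intros r t Hr; unfold scaled_copies.
    pose proof (merge_at (map (fun k => sscal (a k) v) (seq 0 n)) r t) as Hm.
    rewrite length_map, length_seq in Hm; rewrite Hm, nth_map_seq by auto; reflexivity. }
  assert (Xc := X_scaled_copies v a n Xv).
  destruct (X_dom X nX HX (scaled_copies v a n) w
              (fun j => (j mod B) * n + j / B)%nat) as [Xw Lw]; auto.
  - intros j Hj; rewrite Hw in *; destruct (Nat.ltb_spec (j / B) n); [|lra].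
    rewrite Hc by auto; lra.
  - intros i j Hi Hj E; rewrite Hw in *.
    destruct (Nat.ltb_spec (i / B) n), (Nat.ltb_spec (j / B) n); try lra.
    apply pair_inj in E; auto.
    rewrite (divmod_eq i B), (divmod_eq j B) by lia; lia.
  - apply Rle_antisym; auto.
    assert (Hsupp : forall j, scaled_copies v a n j <> 0 -> (j / n < B)%nat).
    { intros j Hj; apply Nat.nle_gt; intros Hle; apply Hj.
      rewrite (divmod_eq j n), Hc by (lia || apply Nat.mod_upper_bound; lia).
      rewrite (Hv (j / n)%nat) by auto; ring. }
    apply (X_dom X nX HX w _ (fun j => (j mod n) * B + j / n)%nat); auto.
    + intros j Hj; apply Hsupp in Hj; rewrite Hw.
      destruct (divmod_pair (j mod n) B (j / n) Hj) as [-> ->].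
      pose proof (Nat.mod_upper_bound j n ltac:(lia)).
      destruct (Nat.ltb_spec (j mod n) n); [|lia].
      rewrite (divmod_eq j n) at 1 by lia; rewrite Hc by auto; lra.
    + intros i j Hi Hj E; apply Hsupp in Hi; apply Hsupp in Hj.
      apply pair_inj in E; auto.
      rewrite (divmod_eq i n), (divmod_eq j n) by lia; lia.
Qed.

Lemma lp_norm_nonneg p n a : 0 <= lp_norm p n a.
Proof.
  assert (F : 0 <= fmaxabs a n).
  { destruct n; simpl; [lra|].
    eapply Rle_trans; [apply Rabs_pos|apply Rmax_r]. }
  destruct p; simpl; auto; apply powabs_nonneg.
Qed.

Lemma lp_equiv_empty p x C : lp_equiv nX p 0 x C.
Proof.
  intros a.
  replace (lp_norm p 0 a) with 0 by (destruct p; simpl; rewrite ?powabs_zero; reflexivity).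
  change (slincomb 0 a x) with szero; rewrite (nX_zero _ _ HX), !Rmult_0_r; lra.
Qed.

Lemma block_representation p :
  Rbar_le 1 p -> fund_mu nX <= exponent p <= fund_nu nX -> sym_block_fin_rep X nX p.
Proof.
  intros Hp Hmn n eps He.
  destruct (Nat.eq_dec n 0) as [->|Hn].
  { exists (fun k => k), (fun _ => 0); repeat split; try (intros; lia).
    all: apply lp_equiv_empty. }
  (* Solves 1 - 2 kappa = 1 / (1 + eps); the upper constant is then below 1 + eps. *)
  set (kappa := eps / (2 * (1 + eps))).
  assert (Hk : 0 < kappa < 1).
  { unfold kappa; split; [apply Rdiv_lt_0_compat; lra|].
    apply Rlt_div_l; lra. }
  assert (K1 : 1 - 2 * kappa = / (1 + eps)) by (unfold kappa; field; lra).
  assert (K2 : 2 * kappa <= eps).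
  { replace (2 * kappa) with (eps / (1 + eps)) by (unfold kappa; field; lra).
    apply Rle_div_l; nra. }
  destruct (scaled_copies_estimate p n kappa Hp Hmn ltac:(lia) Hk)
    as (v & B & HB & Hv0 & Xv & Est).
  exists (fun k => k * B)%nat, (fun i => v (i mod B)%nat); repeat split.
  - intros; nia.
  - assert (Hb : forall k, (1 <= k)%nat ->
       block_coeffs (fun k => k * B)%nat (fun i => v (i mod B)%nat) k = map v (seq 0 B)).
    { intros k Hk1; unfold block_coeffs.
      replace (k * B - pred k * B)%nat with B by (destruct k; simpl; nia).
      apply nth_ext with (d := 0) (d' := 0); rewrite !length_map, !length_seq; auto.
      intros i Hi; rewrite nth_map_seq by auto.
      rewrite (nth_indep _ 0 (v (0 mod B)%nat)) by (rewrite length_map, length_seq; auto).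
      rewrite (map_nth (fun i => v (i mod B)%nat)), seq_nth by auto.
      destruct (divmod_pair (pred k) B i Hi) as [_ ->]; reflexivity. }
    intros k l Hk1 Hl1; rewrite !Hb by lia; reflexivity.
  - intros k Hk1; apply (X_finite X nX HX (k * B)); auto.
    intros j Hj; unfold block; destruct (Nat.ltb_spec j (k * B)); [lia|].
    rewrite Bool.andb_false_r; reflexivity.
  - rewrite norm_slincomb_blocks by (auto; lia).
    rewrite <- K1; apply Est.
  - rewrite norm_slincomb_blocks by (auto; lia).
    eapply Rle_trans; [apply Est|].
    apply Rmult_le_compat_r; [apply lp_norm_nonneg|lra].
Qed.

End Representation.

(** * Necessity *)

(** [same_od] asks for a permutation of all indices, zeros included. Exchanging the two disjoint
    intervals through [f] and [g] and fixing the rest gives an involution, which is its own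
    inverse. *)
Lemma block_swap_same_od (x y : rseq) (s s' L : nat) (f g : nat -> nat) :
  (s + L <= s' \/ s' + L <= s)%nat ->
  (forall r, (r < L)%nat -> (f r < L)%nat /\ (g r < L)%nat /\ g (f r) = r /\ f (g r) = r) ->
  (forall k, ~ (s <= k < s + L)%nat -> x k = 0) ->
  (forall k, ~ (s' <= k < s' + L)%nat -> y k = 0) ->
  (forall r, (r < L)%nat -> y (s' + f r)%nat = x (s + r)%nat) ->
  same_od x y.
Proof.
  intros Hd Hfg Hx Hy Hxy.
  set (pi := fun k =>
    if andb (Nat.leb s k) (Nat.ltb k (s + L)) then (s' + f (k - s))%nat
    else if andb (Nat.leb s' k) (Nat.ltb k (s' + L)) then (s + g (k - s'))%nat
    else k).
  assert (P1 : forall r, (r < L)%nat -> pi (s + r)%nat = (s' + f r)%nat).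
  { intros r Hr; unfold pi.
    destruct (Nat.leb_spec s (s + r)), (Nat.ltb_spec (s + r) (s + L)); simpl; try lia.
    do 2 f_equal; lia. }
  assert (P2 : forall r, (r < L)%nat -> pi (s' + r)%nat = (s + g r)%nat).
  { intros r Hr; unfold pi.
    destruct (Nat.leb_spec s (s' + r)), (Nat.ltb_spec (s' + r) (s + L)); simpl; try lia;
    destruct (Nat.leb_spec s' (s' + r)), (Nat.ltb_spec (s' + r) (s' + L)); simpl; try lia;
    do 2 f_equal; lia. }
  assert (P3 : forall k, ~ (s <= k < s + L)%nat -> ~ (s' <= k < s' + L)%nat -> pi k = k).
  { intros k K1 K2; unfold pi.
    destruct (Nat.leb_spec s k), (Nat.ltb_spec k (s + L)); simpl; try lia;
    destruct (Nat.leb_spec s' k), (Nat.ltb_spec k (s' + L)); simpl; try lia. }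
  assert (Inv : forall k, pi (pi k) = k).
  { intros k.
    destruct (Nat.le_gt_cases s k), (Nat.lt_ge_cases k (s + L));
    destruct (Nat.le_gt_cases s' k), (Nat.lt_ge_cases k (s' + L)); try lia;
    try (rewrite !P3 by (try rewrite P3; lia); reflexivity).
    all: first
      [ replace k with (s + (k - s))%nat by lia;
        destruct (Hfg (k - s)%nat) as (F1 & F2 & F3 & F4); [lia|];
        rewrite P1, P2, F3 by lia; reflexivity
      | replace k with (s' + (k - s'))%nat by lia;
        destruct (Hfg (k - s')%nat) as (F1 & F2 & F3 & F4); [lia|];
        rewrite P2, P1, F4 by lia; reflexivity ]. }
  exists pi, pi; repeat split; auto; intros k.
  destruct (classic (s <= k < s + L)%nat) as [K1|K1].
  - replace k with (s + (k - s))%nat by lia.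
    rewrite P1 by lia; apply Hxy; lia.
  - rewrite (Hx k K1).
    destruct (classic (s' <= k < s' + L)%nat) as [K2|K2].
    + replace k with (s' + (k - s'))%nat by lia.
      rewrite P2 by lia; apply Hy.
      destruct (Hfg (k - s')%nat) as (F1 & F2 & _); lia.
    + rewrite P3 by auto; apply Hy; auto.
Qed.

Lemma same_od_refl x : same_od x x.
Proof. exists (fun k => k), (fun k => k); auto. Qed.

Lemma block_out m c k j : ~ (m (pred k) <= j < m k)%nat -> block m c k j = 0.
Proof.
  intros H; unfold block.
  destruct (Nat.leb_spec (m (pred k)) j), (Nat.ltb_spec j (m k)); simpl; lia || reflexivity.
Qed.

Lemma block_in m c k j : (m (pred k) <= j < m k)%nat -> block m c k j = c j.
Proof.
  intros H; unfold block.
  destruct (Nat.leb_spec (m (pred k)) j), (Nat.ltb_spec j (m k)); simpl; lia || reflexivity.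
Qed.

Lemma increasing_upto (m : nat -> nat) n :
  (forall k, (k < n)%nat -> (m k < m (S k))%nat) ->
  forall i j, (i <= j <= n)%nat -> (m i <= m j)%nat.
Proof.
  intros H i j; induction j as [|j IH]; intros Hij.
  - replace i with 0%nat by lia; auto.
  - destruct (Nat.eq_dec i (S j)) as [->|]; auto.
    specialize (H j ltac:(lia)); specialize (IH ltac:(lia)); lia.
Qed.

Lemma block_rep_fin_rep X nX p : sym_block_fin_rep X nX p -> sym_fin_rep X nX p.
Proof.
  intros Hb n eps He.
  destruct (Hb n eps He) as (m & c & _ & Hm & Hperm & HXb & Heq).
  exists (fun k => block m c (S k)); split; auto.
  pose proof (increasing_upto m n Hm) as Hinc.
  assert (Hsep : forall i j, (i < n)%nat -> (j < n)%nat -> i <> j ->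
            (m (S i) <= m j \/ m (S j) <= m i)%nat).
  { intros i j Hi Hj Hij; destruct (Nat.lt_ge_cases i j) as [L|L].
    - left; apply Hinc; lia.
    - right; apply Hinc; lia. }
  split; [|split].
  - intros k Hk; apply HXb; lia.
  - intros i j Hi Hj Hij t.
    destruct (classic (m i <= t < m (S i))%nat).
    + right; apply block_out; simpl. destruct (Hsep i j Hi Hj Hij); lia.
    + left; apply block_out; simpl; lia.
  - intros i j Hi Hj.
    destruct (Nat.eq_dec i j) as [->|Hij]; [apply same_od_refl|].
    pose proof (Hperm (S i) (S j) ltac:(lia) ltac:(lia)) as HP.
    unfold block_coeffs in HP; simpl pred in HP.
    set (L := (m (S i) - m i)%nat) in *.
    (* The permutation is reversed so that [f] sends offsets in block i to offsets in block j; as an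
       injection of a finite set it has the inverse [g]. *)
    destruct (proj1 (Permutation_nth _ _ 0) (Permutation_sym HP)) as (El & f & F1 & F2 & F3).
    rewrite !length_map, !length_seq in *.
    destruct (bSurjective_bBijective F1 (proj1 (bInjective_bSurjective F1) F2))
      as (g & G1 & G2).
    pose proof (Hm i Hi); pose proof (Hm j Hj).
    apply block_swap_same_od with (s := m i) (s' := m j) (L := L) (f := f) (g := g).
    + destruct (Hsep i j Hi Hj Hij); lia.
    + intros r Hr; rewrite El in Hr; destruct (G2 r Hr); repeat split; auto;
        rewrite El; [apply F1|apply G1]; auto.
    + intros k Hk; apply block_out; simpl; lia.
    + intros k Hk; apply block_out; simpl; lia.
    + intros r Hr; rewrite El in Hr; specialize (F3 r Hr).
      pose proof (F1 r Hr).
      rewrite !block_in by (simpl; lia).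
      rewrite !(nth_indep _ 0 (c 0%nat)) in F3 by (rewrite length_map, length_seq; lia).
      rewrite !map_nth, !seq_nth in F3 by lia; auto.
Qed.

Lemma fin_rep_crude X nX p : sym_fin_rep X nX p -> crude_sym_fin_rep X nX p.
Proof.
  intros H; exists (1 + 1); split; [lra|]; intros n.
  destruct (H n 1 Rlt_0_1) as [x [Hx Heq]]; exists x; auto.
Qed.

(** * Dilation norms from disjoint copies *)

Lemma lp_norm_ones p n :
  Rbar_le 1 p -> (1 <= n)%nat -> lp_norm p n (fun _ => 1) = exp (exponent p * ln (INR n)).
Proof.
  intros Hp Hn; destruct p as [q| |]; simpl in *; try tauto.
  - rewrite (fsum_ext _ (fun _ => 1)).
    + assert (0 < INR n) by (apply lt_0_INR; lia).
      rewrite fsum_const, Rmult_1_r, powabs_pos, Rabs_pos_eq by lra; reflexivity.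
    + intros; rewrite powabs_pos, Rabs_R1, ln_1, Rmult_0_r, exp_0 by lra; reflexivity.
  - rewrite Rmult_0_l, exp_0; apply Rle_antisym.
    + apply fmaxabs_le; [lra|]; intros; rewrite Rabs_R1; lra.
    + rewrite <- Rabs_R1 at 1; apply (fmaxabs_ge (fun _ => 1) n 0); lia.
Qed.

Lemma lp_norm_unit p n :
  Rbar_le 1 p -> (1 <= n)%nat -> lp_norm p n (fun k => if Nat.eqb k 0 then 1 else 0) = 1.
Proof.
  intros Hp Hn; destruct p as [q| |]; simpl in *; try tauto.
  - assert (P : forall r, powabs 1 r = 1).
    { intros; rewrite powabs_pos, Rabs_R1, ln_1, Rmult_0_r, exp_0 by lra; reflexivity. }
    rewrite (fsum_single _ _ 0%nat) by
      (lia || (intros l _ Hl; destruct (Nat.eqb_spec l 0); [tauto|apply powabs_zero])).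
    simpl; rewrite !P; reflexivity.
  - apply Rle_antisym.
    + apply fmaxabs_le; [lra|]; intros k _; destruct (Nat.eqb k 0);
        rewrite ?Rabs_R1, ?Rabs_R0; lra.
    + rewrite <- Rabs_R1 at 1.
      apply (fmaxabs_ge (fun k => if Nat.eqb k 0 then 1 else 0) n 0); lia.
Qed.

Section Necessity.
Context (X : rseq -> Prop) (nX : rseq -> R).
Context (HX : is_symmetric_seq_space X nX) (H1 : X (indic 1)).

(** Normalising [x] gives the lower bound; the a priori bound [K] keeps the supremum finite, so that
    [real] does not collapse it to 0. *)
Lemma opnorm_bounds (T : rseq -> rseq) K x :
  0 <= K ->
  (forall z, X z -> X (T z) /\ nX (T z) <= K * nX z) ->
  (forall c z, T (sscal c z) = sscal c (T z)) ->
  X x -> 0 < nX x ->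
  nX (T x) / nX x <= opnorm X nX T <= K.
Proof.
  intros HK HT Hs Hx Nx; unfold opnorm.
  assert (B : forall r, (exists z, X z /\ nX z <= 1 /\ r = nX (T z)) -> r <= K).
  { intros r [z [Xz [Nz ->]]]; eapply Rle_trans; [apply HT; auto|].
    rewrite <- (Rmult_1_r K) at 2; apply Rmult_le_compat_l; auto. }
  assert (Ix : 0 < / nX x) by (apply Rinv_0_lt_compat; auto).
  split.
  - apply Lub_real_ge with K; auto.
    exists (sscal (/ nX x) x); split; [|split].
    + eapply X_scal; eauto.
    + rewrite (nX_scal _ _ HX), Rabs_pos_eq by (auto; lra); rewrite Rinv_l; lra.
    + rewrite Hs, (nX_scal _ _ HX), Rabs_pos_eq by (try apply HT; auto; lra).
      unfold Rdiv; ring.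
  - apply Lub_real_le; auto.
Qed.

(** A coordinate of the sum lies in exactly one copy; the permutation of that copy takes it back to
    a position t of [x 0], and the copy number selects the residue class within t's block of the
    dilation. *)
Lemma norm_disjoint_copies n x :
  (1 <= n)%nat -> good_family X n x ->
  nX (slincomb n (fun _ => 1) x) = nX (sigma_up n (x 0%nat)).
Proof.
  intros Hn (HXx & Hdis & Hod).
  set (s := slincomb n (fun _ => 1) x).
  assert (Hs : forall k j, (k < n)%nat -> x k j <> 0 -> s j = x k j).
  { intros k j Hk Hne; unfold s, slincomb.
    rewrite (fsum_single _ _ k Hk); [ring|].
    intros l Hl Hlk; destruct (Hdis l k Hl Hk Hlk j) as [->|]; [ring|tauto]. }
  assert (Hs' : forall j, s j <> 0 -> exists k, (k < n)%nat /\ x k j <> 0).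
  { intros j Hj; apply NNPP; intros Hno; apply Hj; unfold s, slincomb.
    apply fsum_zero; intros k Hk; rewrite Rmult_1_l.
    apply NNPP; intros Hne; apply Hno; exists k; auto. }
  assert (Hchoice : exists pi pinv : nat -> nat -> nat, forall k, (k < n)%nat ->
            (forall t, pinv k (pi k t) = t) /\ (forall t, pi k (pinv k t) = t) /\
            forall t, x k (pi k t) = x 0%nat t).
  { set (Q := fun k (fg : (nat -> nat) * (nat -> nat)) =>
        (forall t, snd fg (fst fg t) = t) /\ (forall t, fst fg (snd fg t) = t) /\
        forall t, x k (fst fg t) = x 0%nat t).
    set (w := fun k => epsilon (inhabits (fun t => t, fun t => t)) (Q k)).
    exists (fun k => fst (w k)), (fun k => snd (w k)); intros k Hk.
    apply (epsilon_spec (inhabits (fun t => t, fun t => t)) (Q k)).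
    destruct (Hod 0%nat k ltac:(lia) Hk) as (f & g & A); exists (f, g); exact A. }
  destruct Hchoice as (pi & pinv & Hpi).
  set (kk := fun j => epsilon (inhabits 0%nat) (fun k => (k < n)%nat /\ x k j <> 0)).
  assert (Hkk : forall j, s j <> 0 -> (kk j < n)%nat /\ x (kk j) j <> 0).
  { intros j Hj; apply epsilon_spec; auto. }
  assert (Xs : X s).
  { apply (X_fsum X nX HX (fun k => sscal 1 (x k))); intros; eapply X_scal; eauto. }
  assert (Xup : X (sigma_up n (x 0%nat))).
  { apply (X_sigma_up X nX HX); [lia|apply HXx; lia]. }
  apply Rle_antisym.
  - apply (X_dom X nX HX _ _ (fun j => pinv (kk j) j * n + kk j)%nat); auto.
    + intros j Hj; destruct (Hkk j Hj) as [K1 K2]; unfold sigma_up.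
      destruct (divmod_pair (pinv (kk j) j) n (kk j) K1) as [-> _].
      destruct (Hpi _ K1) as (P1 & P2 & P3).
      rewrite <- P3, P2, (Hs (kk j)) by auto; lra.
    + intros i j Hi Hj E; destruct (Hkk i Hi) as [K1 K2], (Hkk j Hj) as [K1' K2'].
      apply pair_inj in E; auto; destruct E as [E1 E2].
      destruct (Hpi _ K1) as (P1 & P2 & P3).
      rewrite <- E1 in E2; rewrite <- (P2 i), <- (P2 j), E2; reflexivity.
  - assert (Hup : forall j, (j mod n < n)%nat) by (intros; apply Nat.mod_upper_bound; lia).
    apply (X_dom X nX HX _ _ (fun j => pi (j mod n) (j / n))%nat); auto.
    + intros j Hj; unfold sigma_up in *.
      destruct (Hpi _ (Hup j)) as (P1 & P2 & P3).
      rewrite (Hs (j mod n)%nat) by (auto; rewrite P3; auto).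
      rewrite P3; lra.
    + intros i j Hi Hj E; unfold sigma_up in *.
      destruct (Hpi _ (Hup i)) as (P1 & P2 & P3), (Hpi _ (Hup j)) as (P1' & P2' & P3').
      assert (Em : (i mod n = j mod n)%nat).
      { apply NNPP; intros Hne.
        destruct (Hdis _ _ (Hup i) (Hup j) Hne (pi (i mod n) (i / n))%nat) as [Z|Z].
        - rewrite P3 in Z; tauto.
        - rewrite E, P3' in Z; tauto. }
      rewrite (divmod_eq i n), (divmod_eq j n) by lia.
      rewrite Em; do 2 f_equal.
      rewrite <- (P1 (i / n)%nat), E, Em; apply P1'.
Qed.

(** Tested on (1, ..., 1) the estimate controls the dilation, on a unit vector it controls [x 0]
    itself; comparing the two costs C twice. *)
Lemma crude_dilation p C n :
  Rbar_le 1 p -> 0 < C -> (1 <= n)%nat ->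
  (exists x, good_family X n x /\ lp_equiv nX p n x C) ->
  exists x, X x /\ 0 < nX x /\
    exp (exponent p * ln (INR n)) * nX x <= C * C * nX (sigma_up n x) /\
    nX (sigma_up n x) <= C * C * exp (exponent p * ln (INR n)) * nX x.
Proof.
  intros Hp HC Hn (x & Hg & Heq).
  pose proof (norm_disjoint_copies n x Hn Hg) as Hs.
  pose proof (Heq (fun _ => 1)) as E1; rewrite lp_norm_ones, Hs in E1 by auto.
  pose proof (Heq (fun k => if Nat.eqb k 0 then 1 else 0)) as E2.
  rewrite lp_norm_unit in E2 by auto.
  replace (slincomb n (fun k => if Nat.eqb k 0 then 1 else 0) x) with (x 0%nat) in E2.
  2:{ apply functional_extensionality; intros j; unfold slincomb.
      rewrite (fsum_single _ _ 0%nat); [simpl; ring|lia|].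
      intros l _ Hl; destruct (Nat.eqb_spec l 0); [tauto|ring]. }
  set (w := exp (exponent p * ln (INR n))) in *.
  assert (Hw : 0 < w) by apply exp_pos.
  assert (IC : 0 < / C) by (apply Rinv_0_lt_compat; auto).
  exists (x 0%nat); repeat split.
  - apply Hg; lia.
  - lra.
  - apply Rle_trans with (w * C); [apply Rmult_le_compat_l; lra|].
    replace (w * C) with (C * C * (/ C * w)) by (field; lra).
    apply Rmult_le_compat_l; [nra|tauto].
  - apply Rle_trans with (C * w); [tauto|].
    replace (C * w) with (C * C * w * (/ C)) by (field; lra).
    apply Rmult_le_compat_l; [repeat apply Rmult_le_pos; lra|lra].
Qed.

Lemma sigma_down_up n x : (1 <= n)%nat -> sigma_down n (sigma_up n x) = x.
Proof.
  intros Hn; apply functional_extensionality; intros j; unfold sigma_down, sigma_up.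
  rewrite (fsum_ext _ (fun _ => x j)).
  - rewrite fsum_const; field; apply not_0_INR; lia.
  - intros k Hk; destruct (divmod_pair j n k Hk) as [-> _]; reflexivity.
Qed.

Lemma sigma_down_scal n c x : sigma_down n (sscal c x) = sscal c (sigma_down n x).
Proof.
  apply functional_extensionality; intros j; unfold sigma_down, sscal.
  rewrite fsum_scal; ring.
Qed.

Lemma crude_boyd p :
  Rbar_le 1 p -> crude_sym_fin_rep X nX p ->
  boyd_alpha X nX <= exponent p <= boyd_beta X nX.
Proof.
  intros Hp (C & HC & Hrep).
  set (theta := exponent p).
  assert (HCC : 0 < C * C) by nra.
  (* The slack [delta] absorbs the constant: C^2 <= n^delta for large n. *)
  enough (HH : forall delta, 0 < delta ->
            boyd_alpha X nX <= theta + delta /\ theta - delta <= boyd_beta X nX).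
  { split; apply Rnot_lt_le; intros Hlt.
    - destruct (HH ((boyd_alpha X nX - theta) / 2)); lra.
    - destruct (HH ((theta - boyd_beta X nX) / 2)); lra. }
  intros delta Hd.
  destruct (ln_INR_unbounded (ln (C * C) / delta)) as [N HN].
  assert (HCn : forall n, (N <= n)%nat -> C * C <= exp (delta * ln (INR n))).
  { intros n Hn; rewrite <- (exp_ln (C * C)) by auto; apply exp_le_exp.
    specialize (HN n Hn); apply Rle_div_l in HN; lra. }
  split.
  - unfold boyd_alpha; apply (Lim_seq_between _ 0 (theta + delta) (N + 2)).
    intros n Hn; rewrite log2_quot.
    enough (- (theta + delta) <= ln (opnorm X nX (sigma_down n)) / ln (INR n) <= 0) by lra.
    destruct (crude_dilation p C n Hp HC ltac:(lia) (Hrep n)) as (x & Xx & Nx & D1 & D2).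
    fold theta in D1, D2.
    destruct (X_sigma_up X nX HX n x ltac:(lia) Xx) as [Xu _].
    assert (Nu : 0 < nX (sigma_up n x)).
    { apply Rmult_lt_reg_l with (C * C); auto; rewrite Rmult_0_r.
      eapply Rlt_le_trans; [|exact D1]. apply Rmult_lt_0_compat; auto; apply exp_pos. }
    (* The test vector is the dilation, which averaging maps back to [x]; the trivial bound 1 gives
       the other side of the limit estimate. *)
    destruct (opnorm_bounds (sigma_down n) 1 (sigma_up n x)) as [O1 O2]; auto.
    + lra.
    + intros z Xz; rewrite Rmult_1_l; apply (X_sigma_down X nX HX); auto; lia.
    + apply sigma_down_scal.
    + rewrite sigma_down_up in O1 by lia.
      apply ln_quot_between; [lia|]; split; [|rewrite Rmult_0_l, exp_0; auto].
      eapply Rle_trans; [|exact O1].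
      apply Rle_div_r; auto.
      apply Rle_trans with (exp (- (theta + delta) * ln (INR n)) *
          (exp (delta * ln (INR n)) * exp (theta * ln (INR n)) * nX x)).
      * apply Rmult_le_compat_l; [left; apply exp_pos|].
        eapply Rle_trans; [exact D2|].
        repeat apply Rmult_le_compat_r; try lra; [left; apply exp_pos|].
        apply HCn; lia.
      * rewrite <- !Rmult_assoc, <- !exp_plus.
        replace (_ + _ + _) with 0 by ring; rewrite exp_0; lra.
  - unfold boyd_beta; apply (Lim_seq_between _ (theta - delta) 1 (N + 2)).
    intros n Hn; rewrite log2_quot.
    destruct (crude_dilation p C n Hp HC ltac:(lia) (Hrep n)) as (x & Xx & Nx & D1 & D2).
    fold theta in D1, D2.
    destruct (opnorm_bounds (sigma_up n) (INR n) x) as [O1 O2]; auto.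
    + apply pos_INR.
    + intros z Xz; apply (X_sigma_up X nX HX); auto; lia.
    + apply ln_quot_between; [lia|]; split; [|rewrite Rmult_1_l, exp_ln_INR by lia; auto].
      eapply Rle_trans; [|exact O1].
      apply Rle_div_r; auto.
      apply Rmult_le_reg_l with (exp (delta * ln (INR n))); [apply exp_pos|].
      rewrite <- Rmult_assoc, <- exp_plus.
      replace (delta * ln (INR n) + (theta - delta) * ln (INR n))
        with (theta * ln (INR n)) by ring.
      eapply Rle_trans; [exact D1|].
      apply Rmult_le_compat_r; [|apply HCn; lia].
      eapply nX_pos; eauto; apply (X_sigma_up X nX HX); auto; lia.
Qed.

End Necessity.

(** Inversion reverses order on nonnegative reals with 1/0 = oo: [alpha] = 0 leaves [p] unbounded
    above, and [beta] = 0 forces [p] = oo. *)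
Lemma inv_ext_between alpha beta p :
  0 <= alpha -> 0 <= beta -> Rbar_le 1 p ->
  (Rbar_le (inv_ext beta) p /\ Rbar_le p (inv_ext alpha)) <->
  alpha <= exponent p <= beta.
Proof.
  intros Ha Hb Hp; unfold inv_ext.
  destruct p as [q| |]; simpl in Hp; try tauto; simpl exponent.
  - assert (Iq : 0 < / q) by (apply Rinv_0_lt_compat; lra).
    destruct (Req_EM_T beta 0) as [B|B], (Req_EM_T alpha 0) as [A|A]; simpl;
      split; intros [E1 E2]; split; try tauto; try lra.
    + rewrite <- (Rinv_inv beta); apply Rinv_le_contravar; auto.
      apply Rinv_0_lt_compat; lra.
    + rewrite <- (Rinv_inv q); apply Rinv_le_contravar; auto.
    + rewrite <- (Rinv_inv alpha); apply Rinv_le_contravar; lra.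
    + rewrite <- (Rinv_inv beta); apply Rinv_le_contravar; auto.
      apply Rinv_0_lt_compat; lra.
    + rewrite <- (Rinv_inv q); apply Rinv_le_contravar; auto.
    + rewrite <- (Rinv_inv q); apply Rinv_le_contravar; lra.
  - destruct (Req_EM_T beta 0) as [B|B], (Req_EM_T alpha 0) as [A|A]; simpl;
      split; intros [E1 E2]; split; try tauto; try lra.
Qed.

Theorem theorem5p3 (X : rseq -> Prop) (nX : rseq -> R) (p : Rbar) :
  is_symmetric_seq_space X nX ->
  (exists x, X x /\ x <> szero) ->
  separable X nX ->
  fundamental_type X nX ->
  Rbar_le (Finite 1) p ->
  (sym_block_fin_rep X nX p <-> sym_fin_rep X nX p) /\
  (sym_fin_rep X nX p <-> crude_sym_fin_rep X nX p) /\
  (crude_sym_fin_rep X nX p <->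
     (Rbar_le (inv_ext (boyd_beta X nX)) p /\ Rbar_le p (inv_ext (boyd_alpha X nX)))).
Proof.
  intros HX Hne _ [Ea Eb] Hp.
  assert (H1 : X (indic 1)) by (eapply X_indic1; eauto).
  (* The Boyd indices are nonnegative because fundamental type identifies them with [fund_mu] and
     [fund_nu]. *)
  rewrite inv_ext_between; auto.
  2:{ rewrite Ea; eapply fund_mu_nonneg; eauto. }
  2:{ rewrite Eb; eapply fund_nu_nonneg; eauto. }
  pose proof (block_rep_fin_rep X nX p).
  pose proof (fin_rep_crude X nX p).
  pose proof (crude_boyd X nX HX p Hp).
  assert (boyd_alpha X nX <= exponent p <= boyd_beta X nX -> sym_block_fin_rep X nX p)
    by (rewrite Ea, Eb; apply block_representation; auto).
  tauto.
Qed.
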